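(* Let $a\ge2$ be an integer, $R=\mathbb{Z}/a\mathbb{Z}$, $0<\epsilon<1$, $t\ge0$ an integer and $k$ a positive integer. For each $n$, let $1\le\alpha_n^{(k)}<\cdots<\alpha_n^{(1)}\le n$ and $n+t\ge\beta_n^{(k)}>\cdots>\beta_n^{(1)}\ge1$ be integers, and let $\mathcal{M}$ be an $\epsilon$-balanced random $n\times(n+t)$ matrix over $R$ having $k$-step stairs of $0$ with respect to $\alpha_n^{(i)}$ and $\beta_n^{(i)}$. If $\lim_{n\to\infty}(n-\alpha_n^{(i)}-\beta_n^{(i)})=\infty$ for every $1\le i\le k$, then for every finite abelian group $G$ whose exponent divides $a$, $$\lim_{n\to\infty}\mathbb{E}(\#\mathrm{Sur}(\mathrm{cok}(\mathcal{M}),G))=\frac{1}{|G|^t}.$$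
   Context: A random variable $\xi$ in $R=\mathbb{Z}/a\mathbb{Z}$ is $\epsilon$-balanced if for every maximal ideal $\mathcal{P}$ of $R$ and every $r\in R/\mathcal{P}$, $\mathbb{P}(\xi\equiv r\pmod{\mathcal{P}})\le1-\epsilon$. A random $n\times(n+t)$ matrix $\mathcal{M}$ over $R$ is $\epsilon$-balanced having $k$-step stairs of $0$ with respect to $\alpha_n^{(i)},\beta_n^{(i)}$ if $\mathcal{M}_{i,j}=0$ whenever there is $1\le l\le k$ with $1\le i\le\alpha_n^{(l)}$ and $1\le j\le\beta_n^{(l)}$, and all other entries are independent $\epsilon$-balanced random variables in $R$. $\mathrm{Sur}(A,B)$ is the set of surjective homomorphisms $A\to B$. *)

(* Defs.v *)
From HB Require Import structures.
From mathcomp Require Import all_boot all_order all_algebra.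
From mathcomp Require Import all_fingroup all_solvable.
From mathcomp Require Import all_classical all_reals all_analysis.

Set Implicit Arguments.
Unset Strict Implicit.
Unset Printing Implicit Defensive.

Import Order.TTheory GRing.Theory Num.Theory.
Import numFieldNormedType.Exports.

Local Open Scope classical_set_scope.
Local Open Scope ring_scope.

Section Cokernel.

Variables (a n m : nat).
Implicit Type M : 'M['Z_a]_(n, m).

(* The image of [M], seen as the map from column vectors of length m to column
   vectors of length n. *)
Definition colspan M : {set 'cV['Z_a]_n} :=
  [set (M *m v)%R | v in [set: 'cV['Z_a]_m]%SET]%SET.

Lemma colspan_group_set M : group_set (colspan M).
Proof.
apply/group_setP; split.
  by apply/imsetP; exists 0; rewrite ?inE// mulmx0.
move=> _ _ /imsetP[u _ ->] /imsetP[v _ ->].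
by apply/imsetP; exists (u + v); rewrite ?inE// mulmxDr.
Qed.

Canonical colspan_group M := Group (colspan_group_set M).

Definition cok M : {set coset_of (colspan M)} :=
  ([set: 'cV['Z_a]_n]%SET / colspan M)%g.

End Cokernel.

(* A homomorphism from the subgroup [A] of [aT] is encoded by its extension
   to [aT] taking the value 1 outside [A], so that each one is counted once. *)
Definition Sur (aT rT : finGroupType) (A : {set aT}) (B : {set rT}) :
    {set {ffun aT -> rT}} :=
  [set f : {ffun aT -> rT} |
    [&& morphic A f, (f @: A == B)%SET
      & [forall x, (x \notin A) ==> (f x == 1%g)]]]%SET.

(* [idealr_closed] includes properness. *)
Definition maximal_ideal (S : comNzRingType) (I : {pred S}) : Prop :=
  idealr_closed I /\
  forall J : {pred S},
    idealr_closed J -> {subset I <= J} -> {subset J <= I}.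

Section RandomVariables.

Variables (R : realType) (d : measure_display) (T : measurableType d).
Variable P : probability T R.

Definition discrete_rv (S : Type) (X : T -> S) : Prop :=
  forall B : set S, measurable (X @^-1` B).

(* Mutual independence of the discrete random variables [X i], [i \in D]. *)
Definition independent (I : finType) (S : Type) (D : {set I})
    (X : I -> T -> S) : Prop :=
  forall (J : {set I}) (B : I -> set S), J \subset D ->
    P (\bigcap_(i in [set` J]) (X i @^-1` B i)) =
    (\prod_(i in J) P (X i @^-1` B i))%E.

(* An element of the quotient by [I] is given by a representative [r]. *)
Definition balanced (S : comNzRingType) (eps : R) (xi : T -> S) : Prop :=
  forall I : {pred S}, maximal_ideal I ->
  forall r : S, (P [set w | (xi w - r)%R \in I] <= (1 - eps)%R%:E)%E.

Section Stairs.

Variables (a n m k : nat) (alpha beta : 'I_k -> nat).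

(* Rows and columns are numbered from 0, hence the strict inequalities. *)
Definition stairs : {set 'I_n * 'I_m} :=
  [set p : 'I_n * 'I_m |
    [exists l : 'I_k, (p.1 < alpha l)%N && (p.2 < beta l)%N]]%SET.

Definition balanced_stairs (eps : R) (M : T -> 'M['Z_a]_(n, m)) : Prop :=
  [/\ discrete_rv M,
      forall i j, (i, j) \in stairs -> forall w, M w i j = 0,
      forall i j, (i, j) \notin stairs -> balanced eps (fun w => M w i j)
    & independent (~: stairs)%SET (fun p w => M w p.1 p.2)].

(* The superscript l = 1, ..., k is encoded by the element l - 1 of ['I_k]. *)
Definition stair_shape : Prop :=
  [/\ forall l, (1 <= alpha l <= n)%N,
      forall l l' : 'I_k, (l < l')%N -> (alpha l' < alpha l)%N,
      forall l, (1 <= beta l <= m)%N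
    & forall l l' : 'I_k, (l < l')%N -> (beta l < beta l')%N].

End Stairs.

End RandomVariables.

(* Main.v *)
(** Writing N = |G|, the moment is the sum of P(FM = 0) over the F in G^n that
    generate G.  Expanding the N-th part of 1 over the characters of G column
    by column turns P(FM = 0) into a product over the columns of sums of
    products of characteristic functions of the entries, each of absolute value
    at most some q < 1 as soon as the entry is not a forced 0 and the character
    does not vanish on the corresponding element.  So P(FM = 0) differs from
    N^-(n+t) by at most prod_j V_j(F) / N^(n+t) - N^-(n+t), where
    V_j(F) = sum_chi q^#{i : (i, j) not in the stairs, chi(F_i) <> 0}, and it
    remains to bound the mean of prod_j V_j over the generating F by 1 + o(1).

    V_j decreases when more entries are free, so it suffices to keep a simple
    part of the free entries: fix a constant c, let the last c rows R0 be free
    everywhere and the last c + t columns S be entirely free, and pair row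
    n - c - 1 - j with column j < n - c.  Labelling column j by {l | beta_l <= j}
    splits the remaining rows and columns into at most 2^k square blocks B_y,
    all free.  Restrict F to R0 and let A be the set of the characters that are
    nonzero on at most c / K of these rows.  If A is trivial, then
    V <= 1 + x (V_(B_y) - 1) with x = q^(c / K) on the columns of a block, and
    by convexity (1 + x (V - 1))^r <= 1 - x + x V^r, where V^r has a bounded mean
    for a square block of size r.  If A is not trivial, this confines F on R0 to
    an event of probability about |A|^-c, while V <= |A| - (1 - q) + o(1) on the
    c + t columns in S because F generates G; so this case contributes an
    exponentially small amount in c. *)
Require Import Defs.
From HB Require Import structures.
From mathcomp Require Import all_boot all_order all_algebra.
From mathcomp Require Import all_fingroup all_solvable.
From mathcomp Require Import separable algC cyclotomic classfun character.
From mathcomp Require Import complex.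
From mathcomp Require Import all_classical all_reals all_analysis.
From mathcomp Require Import measurable_realfun ring lra zify.
From mathcomp Require Import fintype finset.

Set Implicit Arguments.
Unset Strict Implicit.
Unset Printing Implicit Defensive.

Import Order.TTheory GRing.Theory Num.Theory.
Import numFieldNormedType.Exports.

Local Open Scope ring_scope.

(** * Averages over families of group elements *)

Section Average.
Variables (R : realFieldType) (Gam I : finType).
Hypothesis Gam_gt0 : (0 < #|Gam|)%N.
Implicit Types (f g : {ffun I -> Gam} -> R) (D : {set I}).

Definition avg f : R := #|Gam|%:R ^- #|I| * \sum_F f F.

Definition depends_on D f :=
  forall F F' : {ffun I -> Gam}, {in D, F =1 F'} -> f F = f F'.

Let N_gt0 : 0 < #|Gam|%:R :> R. Proof. by rewrite ltr0n. Qed.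

Lemma eq_avg f g : f =1 g -> avg f = avg g.
Proof. by move=> fg; rewrite /avg (eq_bigr g) // => F _; exact: fg. Qed.

Lemma avg_le f g : (forall F, f F <= g F) -> avg f <= avg g.
Proof.
move=> fg; apply: ler_wpM2l; first by rewrite invr_ge0 exprn_ge0 // ltW.
by apply: ler_sum => F _.
Qed.

Lemma avgZ k f : avg (fun F => k * f F) = k * avg f.
Proof. by rewrite /avg -mulr_sumr mulrCA. Qed.

Lemma avgD f g : avg (fun F => f F + g F) = avg f + avg g.
Proof. by rewrite /avg big_split /= mulrDr. Qed.

Lemma avg_sum (J : finType) (P : pred J) (h : J -> {ffun I -> Gam} -> R) :
  avg (fun F => \sum_(j | P j) h j F) = \sum_(j | P j) avg (h j).
Proof. by rewrite /avg exchange_big /= mulr_sumr. Qed.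

(** The coordinates of a uniformly random family are independent and uniform on [Gam]; algebraically
    this is distributivity of the product over the sums. *)
Lemma avg_prod (h : I -> Gam -> R) :
  avg (fun F => \prod_i h i (F i)) = \prod_i (#|Gam|%:R^-1 * \sum_x h i x).
Proof.
rewrite /avg -(bigA_distr_bigA h) big_split /= prodr_const exprVn.
by rewrite (eq_card (B := I)).
Qed.

Lemma avg_cst k : avg (fun=> k) = k.
Proof.
rewrite /avg sumr_const card_ffun -[k *+ _]mulr_natl natrX mulrA mulVf ?mul1r //.
by rewrite expf_neq0 // lt0r_neq0.
Qed.

Lemma avg_ge0 f : (forall F, 0 <= f F) -> 0 <= avg f.
Proof. by move=> f0; rewrite -(avg_cst 0); exact: avg_le. Qed.

(* The exchange of the coordinates outside D between two families is an
   involution, under which f(F) g(F') becomes f(F) g(F). *)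
Lemma avg_indep D f g : depends_on D f -> depends_on (~: D) g ->
  avg (fun F => f F * g F) = avg f * avg g.
Proof.
move=> fD gD.
pose mix (p : {ffun I -> Gam} * {ffun I -> Gam}) : {ffun I -> Gam} :=
  [ffun i => if i \in D then p.1 i else p.2 i].
pose sw p := (mix p, mix (p.2, p.1)).
have swK : involutive sw.
  move=> [F F']; rewrite /sw /mix /=.
  by congr pair; apply/ffunP => i; rewrite !ffunE /=; case: ifP => iD;
     rewrite ?ffunE /= ?iD.
have -> : avg f * avg g = #|Gam|%:R ^- #|I| * (#|Gam|%:R ^- #|I| *
    \sum_(p : {ffun I -> Gam} * {ffun I -> Gam}) f p.1 * g p.2).
  rewrite /avg mulrACA -mulrA; congr (_ * (_ * _)).
  rewrite mulr_suml.
  by rewrite -(pair_big predT predT (fun F F' => f F * g F')) /=;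
     apply: eq_bigr => F _; rewrite mulr_sumr.
rewrite (reindex_inj (inv_inj swK)) /=.
have -> : \sum_p f (mix p) * g (mix (p.2, p.1)) =
  \sum_(p : {ffun I -> Gam} * {ffun I -> Gam}) f p.1 * g p.1.
  apply: eq_bigr => -[F F'] _ /=; congr (_ * _).
    by apply: fD => i iD; rewrite ffunE iD.
  by apply: gD => i; rewrite inE => iD; rewrite ffunE /= (negbTE iD).
rewrite -(pair_big predT predT (fun F F' => f F * g F)) /=.
by rewrite exchange_big /= -/(avg (fun=> _)) avg_cst.
Qed.

Lemma depends_on_sub D D' f : D \subset D' -> depends_on D f -> depends_on D' f.
Proof. by move=> /subsetP DD' fD F F' e; apply: fD => i /DD' /e. Qed.

Lemma depends_on_prod (J : eqType) (s : seq J) (D : {set I})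
    (f : J -> {ffun I -> Gam} -> R) :
  (forall j, j \in s -> depends_on D (f j)) ->
  depends_on D (fun F => \prod_(j <- s) f j F).
Proof.
move=> fD F F' e; rewrite !big_seq; apply: eq_bigr => j js; exact: fD.
Qed.

(** Repeated use of [avg_indep]: the tail of the product depends only on coordinates outside [D j],
    by disjointness. *)
Lemma avg_prod_indep (J : finType) (D : J -> {set I})
    (f : J -> {ffun I -> Gam} -> R) :
  (forall j j', j != j' -> [disjoint D j & D j']) ->
  (forall j, depends_on (D j) (f j)) ->
  avg (fun F => \prod_j f j F) = \prod_j avg (f j).
Proof.
move=> dis fD; rewrite -big_enum /=.
under eq_avg do rewrite -big_enum /=.
elim: (enum J) (enum_uniq J) => [_|j s IH /= /andP[js us]].
  by rewrite big_nil; under eq_avg do rewrite big_nil; rewrite avg_cst.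
rewrite big_cons -IH //; under eq_avg do rewrite big_cons.
apply: (avg_indep (D := D j)) => //.
apply: depends_on_prod => j' j's.
apply: depends_on_sub (fD j'); rewrite -disjoints_subset; apply: dis.
by apply: contraNneq js => <-.
Qed.

End Average.

(** * Weights of families *)

(** Jensen's inequality for the power [r] and a variable equal to 1 or [v]. In the induction the two
    sides differ by the covariance [x * (1 - x) * (v - 1) * (v ^+ r - 1)], which is nonnegative. *)
Lemma expr_convex_comb (R : realFieldType) (x v : R) r :
  0 <= x <= 1 -> 1 <= v -> (1 - x + x * v) ^+ r <= 1 - x + x * v ^+ r.
Proof.
move=> /andP[x0 x1] v1; elim: r => [|r IH]; first by rewrite !expr0 mulr1 subrK.
have w1 : 1 <= v ^+ r by rewrite exprn_ege1.
rewrite !exprS; have v0 : 0 <= 1 - x + x * v by nra.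
apply: (le_trans (ler_wpM2l v0 IH)).
have : 0 <= x * (1 - x) * ((v - 1) * (v ^+ r - 1)).
  by rewrite !mulr_ge0 ?subr_ge0.
by nra.
Qed.

Section Weights.
Variables (R : realFieldType) (Gam X : finType) (nz : X -> Gam -> bool) (x0 : X).
Hypothesis Gam_gt0 : (0 < #|Gam|)%N.
Hypothesis nz_x0 : forall g, nz x0 g = false.

(** The duality is kept abstract: [X] stands for the dual group, [x0] for the trivial character and
    [nz chi g] for [chi] being nonzero at [g]. The size bound [card_annihilator] is what is retained
    of the duality between subgroups and annihilators. *)
Definition annihilator (A : {set X}) : {set Gam} :=
  [set g | [forall chi in A, ~~ nz chi g]].

Hypothesis card_annihilator :
  forall A : {set X}, (#|A| * #|annihilator A| <= #|Gam|)%N.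

Variable q : R.
Hypothesis q01 : 0 < q < 1.

Let q_ge0 : 0 <= q. Proof. by case/andP: q01 => /ltW. Qed.
Let q_le1 : q <= 1. Proof. by case/andP: q01 => _ /ltW. Qed.
Let Gam_gt0R : 0 < #|Gam|%:R :> R. Proof. by rewrite ltr0n. Qed.
Local Notation N := (#|X|%:R : R).
Let N_ge1 : 1 <= N.
Proof. by rewrite -[1]/(1%:R) ler_nat; apply/card_gt0P; exists x0. Qed.

Section Family.
Variable I : finType.
Implicit Types (D : {set I}) (F : {ffun I -> Gam}) (A : {set X}) (chi : X).

Definition dweight chi D F : nat := #|[set i in D | nz chi (F i)]|.
Definition weight D F : R := \sum_chi q ^+ dweight chi D F.

Lemma dweight_x0 D F : dweight x0 D F = 0%N.
Proof. by apply: eq_card0 => i; rewrite inE nz_x0 andbF. Qed.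

Lemma dweight_sub chi D D' F : D \subset D' -> (dweight chi D F <= dweight chi D' F)%N.
Proof.
move=> /subsetP DD'; apply/subset_leq_card/subsetP => i.
by rewrite !inE => /andP[/DD' ->].
Qed.

Lemma dweightU chi D D' F : [disjoint D & D'] ->
  dweight chi (D :|: D') F = (dweight chi D F + dweight chi D' F)%N.
Proof.
rewrite -setI_eq0 => /eqP dis; rewrite /dweight -cardsUI.
set B := _ :&: [set i in D' | _].
have /eqP -> : B == set0.
  rewrite -subset0 -dis; apply/subsetP => i; rewrite !inE.
  by move=> /andP[/andP[-> _] /andP[-> _]].
rewrite cards0 addn0; apply: eq_card => i.
by rewrite !inE andb_orl.
Qed.

Lemma expq_le m n : (m <= n)%N -> q ^+ n <= q ^+ m.
Proof. by move=> mn; rewrite ler_wiXn2l ?q_ge0. Qed.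

Lemma weight_sub D D' F : D \subset D' -> weight D' F <= weight D F.
Proof. by move=> DD'; apply: ler_sum => chi _; apply/expq_le/dweight_sub. Qed.

Lemma weight_ge1 D F : 1 <= weight D F.
Proof.
rewrite /weight (bigD1 x0) //= dweight_x0 expr0 lerDl.
by apply: sumr_ge0 => chi _; rewrite exprn_ge0.
Qed.

Lemma weight_le D F : weight D F <= N.
Proof.
rewrite -sum1_card natr_sum; apply: ler_sum => chi _.
by rewrite exprn_ile1.
Qed.

Lemma dweight_depends chi D F F' : {in D, F =1 F'} ->
  dweight chi D F = dweight chi D F'.
Proof.
move=> e; apply: eq_card => i; rewrite !inE.
by case: (boolP (i \in D)) => //= /e ->.
Qed.

Lemma weight_depends D : depends_on D (weight D).
Proof. by move=> F F' e; apply: eq_bigr => chi _; rewrite (dweight_depends _ e). Qed.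

Definition low K D F : {set X} := [set chi | (dweight chi D F <= #|D| %/ K)%N].

Lemma low_depends K D F F' : {in D, F =1 F'} -> low K D F = low K D F'.
Proof. by move=> e; apply/setP => chi; rewrite !inE (dweight_depends _ e). Qed.

Lemma x0_low K D F : x0 \in low K D F.
Proof. by rewrite inE dweight_x0. Qed.

Definition outside A D F : nat := #|[set i in D | F i \notin annihilator A]|.

(** Union bound: a row with [F i] outside the annihilator is detected by some character of [A]. *)
Lemma outside_le A D F : (outside A D F <= \sum_(chi in A) dweight chi D F)%N.
Proof.
apply: (@leq_trans #|\bigcup_(chi in A) [set i in D | nz chi (F i)]|).
  apply/subset_leq_card/subsetP => i; rewrite !inE negb_forall => /andP[iD].
  move=> /existsP[chi]; rewrite negb_imply negbK => /andP[cA cn].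
  by apply/bigcupP; exists chi; rewrite // inE iD.
elim/big_rec2: _ => [|chi m U _ IH]; first by rewrite cards0.
by rewrite (leq_trans (leq_card_setU _ _)) // leq_add2l.
Qed.

(** The rows are independent. A row of [D] lies in the annihilator with probability at most
    [1 / #|A|], and otherwise contributes at most [u]. *)
Lemma avg_outside A D (u : R) : 0 <= u -> A != set0 ->
  avg (fun F => u ^+ outside A D F) <= (#|A|%:R^-1 + u) ^+ #|D|.
Proof.
move=> u0 A0.
pose h (i : I) (g : Gam) : R :=
  if i \in D then if g \notin annihilator A then u else 1 else 1.
have hE F : u ^+ outside A D F = \prod_i h i (F i).
  rewrite -prodr_const big_mkcond /=; apply: eq_bigr => i _.
  by rewrite !inE /h; case: (i \in D) => //=; rewrite inE.
rewrite (eq_avg hE) (@avg_prod _ _ _ h) -prodr_const [X in _ <= X]big_mkcond /=.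
have A_gt0 : 0 < #|A|%:R :> R by rewrite ltr0n card_gt0.
apply: ler_prod => i _; apply/andP; split.
  rewrite mulr_ge0 ?invr_ge0 ?(ltW Gam_gt0R) // sumr_ge0 // => g _.
  by rewrite /h; do 2?case: ifP.
case: ifP => iD; rewrite /h iD; last first.
  by rewrite sumr_const -[1 *+ _]/(_%:R) mulVf // lt0r_neq0.
rewrite (bigID (fun g => g \in annihilator A)) /= mulrDr lerD //.
  rewrite (eq_bigr (fun=> 1)) => [|g ->//].
  rewrite sumr_const ler_pdivrMl // ler_pdivlMr //.
  by rewrite mulrC -natrM ler_nat.
rewrite (eq_bigr (fun=> u)) => [|g ->//].
rewrite sumr_const ler_pdivrMl // -[_ *+ _]mulr_natl; apply: ler_wpM2r => //; rewrite ler_nat.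
by apply: max_card.
Qed.

(** An exponential Markov (Chernoff) bound. If all of [A] is low, at most [#|X| * (#|D| %/ K)] rows
    fall outside the annihilator, so the indicator is at most a power of [u^-1] times
    [u ^+ outside A D F]; the choice of [K] makes that power cost only a factor [1 + u] per row. *)
Lemma avg_low A K D (u : R) : 0 < u <= 1 -> A != set0 ->
  (u^-1) ^+ #|X| <= (1 + u) ^+ K ->
  avg (fun F => (A \subset low K D F)%:R) <=
  ((1 + u * N) * (1 + u) / #|A|%:R) ^+ #|D|.
Proof.
move=> /andP[u0 u1] A0 uK; set k := (#|D| %/ K)%N.
have A_gt0 : 0 < #|A|%:R :> R by rewrite ltr0n card_gt0.
have AN : #|A|%:R <= N by rewrite ler_nat max_card.
have uV1 : 1 <= u^-1 by rewrite invf_ge1.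
have h F : (A \subset low K D F)%:R <= (1 + u) ^+ #|D| * u ^+ outside A D F.
  case: (boolP (A \subset _)) => [/subsetP Alow|_]; last first.
    by rewrite mulr_ge0 // exprn_ge0 // ?addr_ge0 // ltW.
  have out : (outside A D F <= #|X| * k)%N.
    apply: leq_trans (outside_le A D F) _.
    apply: (@leq_trans (\sum_(chi in A) k)).
      by apply: leq_sum => chi /Alow; rewrite inE.
    by rewrite sum_nat_const leq_mul2r max_card orbT.
  have : 1 <= (u^-1) ^+ (#|X| * k) * u ^+ outside A D F.
    rewrite -{1}(subnK out) exprD -mulrA -exprMn mulVf ?lt0r_neq0 //.
    by rewrite expr1n mulr1 exprn_ege1.
  move=> /le_trans; apply; rewrite ler_wpM2r ?exprn_ge0 ?(ltW u0) //.
  rewrite exprM; apply: (@le_trans _ _ (((1 + u) ^+ K) ^+ k)).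
    by rewrite lerXn2r // nnegrE exprn_ge0 // ?invr_ge0 ?addr_ge0 // ltW.
  by rewrite -exprM ler_weXn2l ?lerDl ?(ltW u0) // mulnC leq_trunc_div.
apply: le_trans (avg_le h) _; rewrite avgZ.
rewrite [(1 + u * N) * _]mulrC -mulrA exprMn ler_wpM2l //.
  by rewrite exprn_ge0 // addr_ge0 // ltW.
apply: le_trans (avg_outside D (ltW u0) A0) _.
rewrite lerXn2r // ?nnegrE ?addr_ge0 ?invr_ge0 ?(ltW A_gt0) ?(ltW u0) //.
  by rewrite mulr_ge0 ?invr_ge0 ?addr_ge0 ?mulr_ge0 ?(ltW u0) ?(ltW A_gt0) ?(le_trans _ N_ge1).
rewrite mulrDl mul1r lerD2l -mulrA ler_pMr //.
by rewrite ler_pdivlMr // mul1r.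
Qed.

Lemma avg_annihilated A D : A != set0 ->
  avg (fun F => [forall chi in A, dweight chi D F == 0%N]%:R) <=
  (#|A|%:R^-1 : R) ^+ #|D|.
Proof.
(* Taking [u = 0] in [avg_outside]: since [0 ^+ 0 = 1], the power is the indicator that no row is
   outside. *)
move=> A0; apply: le_trans (_ : avg (fun F => 0 ^+ outside A D F) <= _).
  apply: avg_le => // F; case: (boolP [forall _ in _, _]) => [/forall_inP dz|_].
    suff /eqP -> : outside A D F == 0%N by rewrite expr0.
    by rewrite -leqn0 (leq_trans (outside_le A D F)) // big1 // => chi /dz /eqP.
  by rewrite exprn_ge0.
by apply: le_trans (avg_outside D (lexx 0) A0) _; rewrite addr0.
Qed.

(** A character that is not low is nonzero on more than [#|D| %/ K] rows, so its term is
    negligible. *)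
Lemma weight_low_le K D D' F : D \subset D' ->
  weight D' F <= \sum_(chi in low K D F) q ^+ dweight chi D' F
                 + N * q ^+ (#|D| %/ K).
Proof.
move=> DD'; rewrite /weight (bigID (mem (low K D F))) /= lerD2l.
apply: (@le_trans _ _ (\sum_(chi | chi \notin low K D F) q ^+ (#|D| %/ K))).
  apply: ler_sum => chi; rewrite inE -ltnNge => /ltnW d.
  by rewrite expq_le // (leq_trans d) // dweight_sub.
rewrite sumr_const -[_ *+ _]mulr_natl ler_wpM2r ?exprn_ge0 //.
by rewrite ler_nat max_card.
Qed.

Lemma sum_low_le A D F :
  \sum_(chi in A) q ^+ dweight chi D F <= #|A|%:R.
Proof.
rewrite -sum1_card natr_sum; apply: ler_sum => chi _.
by rewrite exprn_ile1.
Qed.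

(** One nonzero value already lowers the term of [chi] from 1 to at most [q]. This small gain is
    what later beats the factors lost in counting. *)
Lemma sum_low_drop A D F chi : chi \in A -> (0 < dweight chi D F)%N ->
  \sum_(chi in A) q ^+ dweight chi D F <= #|A|%:R - (1 - q).
Proof.
move=> cA d0; rewrite (bigD1 chi) //= (cardsD1 chi) cA natrD -[true%:R]/(1 : R).
have -> : \sum_(i in A | i != chi) q ^+ dweight i D F =
  \sum_(i in A :\ chi) q ^+ dweight i D F.
  by apply: eq_bigl => i; rewrite !inE andbC.
have := sum_low_le (A :\ chi) D F.
have : q ^+ dweight chi D F <= q by rewrite -[X in _ <= X]expr1 expq_le.
by lra.
Qed.

End Family.

Variables (u C : R) (K : nat).
(** In [avg_low] a row costs [tau / #|A|], while a column gains the factor [#|A| - (1 - q)] up to a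
    small error. As [#|A| <= N], the product of the two is at most [kap], which has to stay below
    1. *)
Let tau := (1 + u * N) * (1 + u).
Let kap := tau * (1 - (1 - q) / N).
Hypothesis u01 : 0 < u <= 1.
Hypothesis uK : (u^-1) ^+ #|X| <= (1 + u) ^+ K.
Hypothesis tau_le2 : tau <= 2.
Hypothesis kap_le1 : kap <= 1.
Hypothesis C_bound : forall r, (1 + 2 * N * q ^+ (r %/ K)) ^+ r <= C.

Let u_gt0 : 0 < u. Proof. by case/andP: u01. Qed.
Let N_gt0 : 0 < N. Proof. exact: lt_le_trans N_ge1. Qed.
Let tau_gt0 : 0 < tau.
Proof. by rewrite mulr_gt0 // ?addr_gt0 ?mulr_gt0. Qed.
Let kap_ge0 : 0 <= kap.
Proof.
rewrite mulr_ge0 ?(ltW tau_gt0) // subr_ge0 ler_pdivrMr // mul1r.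
by apply: le_trans N_ge1; rewrite gerBl.
Qed.

Lemma drop_base_le (A : {set X}) (r : nat) : A != set0 ->
  0 <= #|A|%:R - (1 - q) + N * q ^+ (r %/ K) /\
  (tau / #|A|%:R) ^+ r * (#|A|%:R - (1 - q) + N * q ^+ (r %/ K)) ^+ r <=
  (kap + 2 * N * q ^+ (r %/ K)) ^+ r.
Proof.
move=> A0; set x := q ^+ _.
have x_ge0 : 0 <= x by rewrite exprn_ge0.
have A_ge1 : 1 <= #|A|%:R :> R by rewrite -[1]/(1%:R) ler_nat card_gt0.
have A_gt0 : 0 < #|A|%:R :> R by apply: lt_le_trans A_ge1.
have AN : #|A|%:R <= N by rewrite ler_nat max_card.
have Nx : 0 <= N * x by rewrite mulr_ge0 // ltW.
have B0 : 0 <= #|A|%:R - (1 - q) + N * x.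
  by move: q_ge0 A_ge1 Nx; lra.
split => //.
rewrite -exprMn; apply: lerXn2r; rewrite ?nnegrE.
- by rewrite mulr_ge0 // divr_ge0 ?(ltW tau_gt0) ?(ltW A_gt0).
- by rewrite addr_ge0 // -mulrA mulr_ge0.
have -> : tau / #|A|%:R * (#|A|%:R - (1 - q) + N * x) =
  tau * (1 - (1 - q) / #|A|%:R) + tau * (N * x) / #|A|%:R.
  by field; rewrite lt0r_neq0.
rewrite lerD //.
  rewrite /kap ler_wpM2l ?(ltW tau_gt0) // lerD2l lerN2.
  by rewrite ler_wpM2l ?subr_ge0 // lef_pV2 ?posrE.
rewrite ler_pdivrMr // -mulrA.
apply: (@le_trans _ _ (2 * (N * x))); first by rewrite ler_wpM2r.
by rewrite ler_peMr // mulr_ge0.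
Qed.

Let C_ge0 : 0 <= C.
Proof. by apply: le_trans (C_bound 0); rewrite expr0. Qed.

Definition weight_bound : R := (2 ^ #|X|)%:R * (C + C).

Lemma weight_bound_ge0 : 0 <= weight_bound.
Proof. by rewrite mulr_ge0 // addr_ge0. Qed.

(** The families are sorted by their set [A] of low characters. If [A] vanishes identically on [D],
    the weight is at most [#|A| + N * x], on an event of probability at most [#|A| ^- r]. Otherwise
    some character of [A] is nonzero somewhere, the weight drops by [1 - q], and [drop_base_le]
    absorbs the weaker probability bound. Either case contributes at most [C], and there are at most
    [2 ^ #|X|] sets [A]. *)
Lemma avg_weight_exp (I : finType) (D : {set I}) :
  avg (fun F => weight D F ^+ #|D|) <= weight_bound.
Proof.
set r := #|D|; set x := q ^+ (r %/ K).
have x_ge0 : 0 <= x by rewrite exprn_ge0.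
have Nx : 0 <= N * x by rewrite mulr_ge0 // ltW.
pose g1 (A : {set X}) (F : {ffun I -> Gam}) : R :=
  (#|A|%:R + N * x) ^+ r * [forall chi in A, dweight chi D F == 0%N]%:R.
pose g2 (A : {set X}) (F : {ffun I -> Gam}) : R :=
  (#|A|%:R - (1 - q) + N * x) ^+ r * (A \subset low K D F)%:R.
have g1_ge0 A F : 0 <= g1 A F.
  by rewrite mulr_ge0 // exprn_ge0 // addr_ge0.
have g2_ge0 A F : A != set0 -> 0 <= g2 A F.
  by move=> A0; rewrite mulr_ge0 // exprn_ge0 // (drop_base_le r A0).1.
have h F : weight D F ^+ r <= \sum_(A | A != set0) (g1 A F + g2 A F).
  pose A := low K D F.
  have A0 : A != set0 by apply/set0Pn; exists x0; apply: x0_low.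
  have w0 : 0 <= weight D F by apply: le_trans (weight_ge1 D F).
  rewrite (bigD1 A) //= -[X in X <= _]addr0 lerD //; last first.
    apply: sumr_ge0 => B /andP[B0 _]; apply: addr_ge0; [exact: g1_ge0|exact: g2_ge0].
  have wl := @weight_low_le _ K D D F (subxx D).
  case: (boolP [forall chi in A, dweight chi D F == 0%N]) => [dz|].
    apply: (@le_trans _ _ (g1 A F)); last by rewrite lerDl g2_ge0.
    rewrite /g1 dz mulr1 lerXn2r ?nnegrE ?addr_ge0 //.
    by apply: (le_trans wl); rewrite lerD2r; apply: sum_low_le.
  rewrite negb_forall => /existsP[chi]; rewrite negb_imply -lt0n => /andP[cA d0].
  apply: (@le_trans _ _ (g2 A F)); last by rewrite lerDr g1_ge0.
  rewrite /g2 subxx mulr1 lerXn2r ?nnegrE ?(drop_base_le r A0).1 //.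
  by apply: (le_trans wl); rewrite lerD2r; apply: sum_low_drop d0.
apply: (le_trans (avg_le h)); rewrite avg_sum /weight_bound.
apply: (@le_trans _ _ (\sum_(A : {set X} | A != set0) (C + C))); last first.
  rewrite sumr_const -[_ *+ _]mulr_natl ler_wpM2r ?addr_ge0 // ler_nat.
  by rewrite -cardsT -card_powerset; apply: subset_leq_card; apply/subsetP => A _;
     rewrite inE subsetT.
apply: ler_sum => A A0; rewrite avgD !avgZ lerD //.
  have A_ge1 : 1 <= #|A|%:R :> R by rewrite -[1]/(1%:R) ler_nat card_gt0.
  have A_gt0 : 0 < #|A|%:R :> R by apply: lt_le_trans A_ge1.
  apply: (le_trans (ler_wpM2l _ (avg_annihilated D A0))).
    by rewrite exprn_ge0 // addr_ge0.
  rewrite -exprMn; apply: le_trans (C_bound r).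
  rewrite lerXn2r ?nnegrE ?mulr_ge0 ?addr_ge0 ?invr_ge0 ?mulr_ge0 ?(ltW N_gt0) //.
  rewrite mulrDl divff ?lt0r_neq0 // lerD2l ler_pdivrMr //.
  rewrite -/x; apply: (@le_trans _ _ (2 * N * x)).
    by move: Nx; lra.
  by rewrite ler_peMr // -mulrA mulr_ge0.
apply: (le_trans (ler_wpM2l _ (avg_low D u01 A0 uK))).
  by rewrite exprn_ge0 // (drop_base_le r A0).1.
rewrite mulrC; apply: (le_trans (drop_base_le r A0).2).
apply: le_trans (C_bound r); rewrite lerXn2r ?nnegrE ?addr_ge0 //.
- by rewrite -mulrA mulr_ge0.
- by rewrite -mulrA mulr_ge0.
- by rewrite lerD2r.
Qed.

(** * Mean product of the column weights for a staircase pattern *)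

Section Staircase.
Variables (I J L : finType) (free : I -> J -> bool).
Variables (R0 : {set I}) (S : {set J}) (lam : I -> L) (mu : J -> L) (t : nat).
Let c := #|R0|.
Local Notation Rb y := [set i | (i \notin R0) && (lam i == y)].
Hypothesis card_S : #|S| = (c + t)%N.
Hypothesis card_block :
  forall y, #|Rb y| = #|[set j | (j \notin S) && (mu j == y)]|.
Hypothesis free_S : forall i j, j \in S -> free i j.
Hypothesis free_R0 : forall i j, i \in R0 -> free i j.
Hypothesis free_block : forall i j, j \notin S -> lam i = mu j -> free i j.

Let x := q ^+ (c %/ K).
Let x_ge0 : 0 <= x. Proof. by rewrite exprn_ge0. Qed.
Let x_le1 : x <= 1. Proof. by rewrite exprn_ile1. Qed.

(** Up to the factor [1 / #|Gam|], this bounds the modulus of the factor of column [j] in the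
    character expansion. *)
Definition column_weight (F : {ffun I -> Gam}) (j : J) : R :=
  \sum_chi q ^+ #|[set i | free i j && nz chi (F i)]|.

Let w0 (D : {set I}) F : 0 <= weight D F.
Proof. by apply: le_trans (weight_ge1 D F). Qed.

(** Forgetting free entries only increases a weight. Columns of [S] keep every row, and a column
    labelled [y] keeps [R0] and the rows labelled [y]; by [card_block] there are as many such
    columns as rows of the block. *)
Lemma prod_column_weight_le F :
  \prod_j column_weight F j <=
  weight [set: I] F ^+ (c + t) * \prod_y weight (R0 :|: Rb y) F ^+ #|Rb y|.
Proof.
have cwE j : column_weight F j = weight [set i | free i j] F.
  by apply: eq_bigr => chi _; congr (_ ^+ _); apply: eq_card => i; rewrite !inE.
under eq_bigr do rewrite cwE.
rewrite (bigID (mem S)) /= ler_pM ?prodr_ge0 //.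
  rewrite -card_S -prodr_const ler_prod // => j jS.
  by rewrite w0 /=; apply: weight_sub; apply/subsetP => i _; rewrite inE free_S.
rewrite (partition_big mu predT) //= ler_prod // => y _.
rewrite prodr_ge0 //= card_block -prodr_const.
rewrite [X in _ <= X](eq_bigl (fun j => (j \notin S) && (mu j == y))); last first.
  by move=> j; rewrite inE.
rewrite ler_prod // => j /andP[jS /eqP jy]; rewrite w0 /=.
apply: weight_sub; apply/subsetP => i; rewrite !inE => /orP[/free_R0 ->//|].
by move=> /andP[_ /eqP iy]; rewrite free_block // iy jy.
Qed.

Lemma disjoint_R0 y : [disjoint R0 & Rb y].
Proof.
rewrite disjoints_subset; apply/subsetP => i iR; rewrite !inE iR.
by [].
Qed.

Lemma avg_prod_blocks (h : L -> R -> R) :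
  avg (fun F => \prod_y h y (weight (Rb y) F)) =
  \prod_y avg (fun F => h y (weight (Rb y) F)).
Proof.
apply: (avg_prod_indep Gam_gt0 (D := fun y => Rb y)) => [y y' yy'|y F F' e].
  rewrite disjoints_subset; apply/subsetP => i; rewrite !inE.
  by move=> /andP[-> /eqP ->]; rewrite negb_and yy' orbT.
by rewrite (weight_depends e).
Qed.

Variable gen : pred {ffun I -> Gam}.
Hypothesis genP : forall F, gen F -> forall chi, chi != x0 -> exists i, nz chi (F i).

(** Every nontrivial character is nonzero on more than [c %/ K] rows of [R0], which multiplies its
    term by at most [x]. *)
Lemma weight_nondegenerate F y : low K R0 F = [set x0] ->
  weight (R0 :|: Rb y) F <= 1 - x + x * weight (Rb y) F.
Proof.
move=> lowF; rewrite /weight (bigD1 x0) //= [X in x * X](bigD1 x0) //= !dweight_x0 expr0 mulrDr mulr1.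
rewrite addrA subrK lerD2l mulr_sumr; apply: ler_sum => chi cx.
rewrite dweightU ?disjoint_R0 // exprD ler_wpM2r ?exprn_ge0 // expq_le //.
have : chi \notin low K R0 F by rewrite lowF inE.
by rewrite inE -ltnNge => /ltnW.
Qed.

(** The first summand comes from the families whose only low character on [R0] is [x0]. The second
    bounds the others, summed over the possible sets [A] of low characters. *)
Theorem avg_staircase :
  avg (fun F => (gen F)%:R * \prod_j column_weight F j) <=
  (1 + N * x) ^+ (c + t) * (1 + x * weight_bound) ^+ #|L| +
  (2 ^ #|X|)%:R * (N ^+ t * (kap + 2 * N * x) ^+ c * weight_bound ^+ #|L|).
Proof.
have Nx : 0 <= N * x by rewrite mulr_ge0 // ltW.
pose g1 (F : {ffun I -> Gam}) : R := (1 + N * x) ^+ (c + t) *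
  \prod_y (1 - x + x * weight (Rb y) F ^+ #|Rb y|).
pose g2 (A : {set X}) (F : {ffun I -> Gam}) : R :=
  N ^+ t * (#|A|%:R - (1 - q) + N * x) ^+ c * ((A \subset low K R0 F)%:R *
  \prod_y weight (Rb y) F ^+ #|Rb y|).
have g1_ge0 F : 0 <= g1 F.
  rewrite mulr_ge0 ?exprn_ge0 ?addr_ge0 // prodr_ge0 // => y _.
  by rewrite addr_ge0 ?subr_ge0 // mulr_ge0 // exprn_ge0.
have g2_ge0 A F : A != set0 -> 0 <= g2 A F.
  move=> A0; rewrite !mulr_ge0 ?prodr_ge0 ?exprn_ge0 ?(ltW N_gt0) //.
  - exact: (drop_base_le c A0).1.
  - by move=> y _; rewrite exprn_ge0.
have h F : (gen F)%:R * \prod_j column_weight F j <=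
    g1 F + \sum_(A | A != set0) g2 A F.
  have s0 : 0 <= \sum_(A | A != set0) g2 A F.
    by apply: sumr_ge0 => A; apply: g2_ge0.
  case: (boolP (gen F)) => [gF|_]; last by rewrite mul0r addr_ge0.
  rewrite mul1r; apply: (le_trans (prod_column_weight_le F)).
  pose A := low K R0 F.
  have A0 : A != set0 by apply/set0Pn; exists x0; apply: x0_low.
  have wl := @weight_low_le _ K R0 [set: I] F (subsetT _).
  case: (eqVneq A [set x0]) => [Ax|Ax].
    apply: (@le_trans _ _ (g1 F)); last by rewrite lerDl.
    rewrite /g1 ler_pM ?exprn_ge0 ?prodr_ge0 //.
    - by move=> y _; rewrite exprn_ge0.
    - rewrite lerXn2r ?nnegrE ?addr_ge0 //; apply: (le_trans wl).
      rewrite lerD2r -/A Ax big_set1 dweight_x0 expr0 //.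
    - apply: ler_prod => y _; rewrite exprn_ge0 //=.
      apply: le_trans (@expr_convex_comb _ x (weight (Rb y) F) _ _ _);
        rewrite ?x_ge0 ?weight_ge1 //.
      rewrite lerXn2r ?nnegrE //.
        by rewrite addr_ge0 ?subr_ge0 // mulr_ge0.
      exact: weight_nondegenerate.
  apply: (@le_trans _ _ (g2 A F)); last first.
    rewrite -[X in X <= _]add0r lerD // (bigD1 A) //= lerDl.
    by apply: sumr_ge0 => B /andP[B0 _]; apply: g2_ge0.
  rewrite /g2 subxx mul1r ler_pM ?exprn_ge0 ?prodr_ge0 //.
  - by move=> y _; rewrite exprn_ge0.
  (* Of the [c + t] columns of [S], [t] are bounded trivially by [N]; the other [c] gain [1 - q]
     each, which is matched against the [c] rows of [R0]. *)
  - rewrite addnC exprD ler_pM ?exprn_ge0 //.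
      by rewrite lerXn2r ?nnegrE ?(ltW N_gt0) // weight_le.
    rewrite lerXn2r ?nnegrE ?(drop_base_le c A0).1 //.
    (* [A] contains [x0] and differs from [[set x0]], so it has a nontrivial character. Generation
       makes it nonzero on some row, possibly outside [R0], and the columns of [S] are free in that
       row as well. *)
    have [chi cA cx] : exists2 chi, chi \in A & chi != x0.
      apply/exists_inP; rewrite -negb_forall_in; apply: contra Ax => /forall_inP e.
      apply/eqP/setP => chi; rewrite inE; apply/idP/eqP => [/e/eqP//|->].
      exact: x0_low.
    have [i ni] := genP gF cx.
    apply: (le_trans wl); rewrite lerD2r; apply: sum_low_drop cA _.
    by apply/card_gt0P; exists i; rewrite !inE.
  - apply: ler_prod => y _; rewrite exprn_ge0 //=.
    by rewrite lerXn2r ?nnegrE // weight_sub // subsetUr.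
apply: (le_trans (avg_le h)); rewrite avgD avg_sum lerD //.
  rewrite avgZ ler_wpM2l ?exprn_ge0 ?addr_ge0 //.
  rewrite (avg_prod_blocks (fun y w => 1 - x + x * w ^+ #|Rb y|)).
  rewrite -(eq_card (fun=> erefl : _ = (_ \in L))) -prodr_const.
  apply: ler_prod => y _.
  rewrite avgD avg_cst // avgZ; apply/andP; split.
    rewrite addr_ge0 ?subr_ge0 // mulr_ge0 // avg_ge0 // => F.
    by rewrite exprn_ge0.
  by rewrite lerD ?gerBl // ler_wpM2l // avg_weight_exp.
apply: (@le_trans _ _ (\sum_(A : {set X} | A != set0)
   (N ^+ t * (kap + 2 * N * x) ^+ c * weight_bound ^+ #|L|))); last first.
  rewrite sumr_const -[_ *+ _]mulr_natl ler_wpM2r //.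
    rewrite !mulr_ge0 ?exprn_ge0 ?weight_bound_ge0 ?(ltW N_gt0) //.
    by rewrite addr_ge0 // -mulrA mulr_ge0.
  rewrite ler_nat -cardsT -card_powerset; apply: subset_leq_card.
  by apply/subsetP => A _; rewrite inE subsetT.
apply: ler_sum => A A0; rewrite avgZ.
(* The low set is determined by the rows of [R0] and the block weights by the remaining rows, so the
   two factors are independent. *)
rewrite (@avg_indep _ _ _ Gam_gt0 R0); last 2 first.
- by move=> F F' e; rewrite (low_depends _ e).
- move=> F F' e; apply: eq_bigr => y _; rewrite (@weight_depends _ (Rb y) F F') //.
  move=> i iR; apply: e; rewrite inE.
  by apply/negP => /(disjointFr (disjoint_R0 y)); rewrite iR.
rewrite (avg_prod_blocks (fun y w => w ^+ #|Rb y|)).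
have Nt : 0 <= N ^+ t by rewrite exprn_ge0 // ltW.
have Bc : 0 <= (#|A|%:R - (1 - q) + N * x) ^+ c.
  by rewrite exprn_ge0 // (drop_base_le c A0).1.
have lowA := avg_low R0 u01 A0 uK.
have low0 : 0 <= avg (fun F => (A \subset low K R0 F)%:R) :> R.
  by apply: avg_ge0 => // F; rewrite ler0n.
set e1 := avg _ in lowA low0 *; rewrite [X in X <= _]mulrA; apply: ler_pM.
- by apply: mulr_ge0 => //; apply: mulr_ge0.
- by apply: prodr_ge0 => y _; apply: avg_ge0 => // F; rewrite exprn_ge0.
- rewrite -[X in X <= _]mulrA ler_wpM2l // [X in X <= _]mulrC.
  by apply: le_trans (drop_base_le c A0).2; rewrite ler_wpM2r.
rewrite -(eq_card (fun=> erefl : _ = (_ \in L))) -prodr_const.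
apply: ler_prod => y _; rewrite avg_weight_exp andbT.
by apply: avg_ge0 => // F; rewrite exprn_ge0.
Qed.

End Staircase.
End Weights.

(** * Asymptotics of the bound *)

Section Asymptotics.
Variable R : realType.
Implicit Types (q w : R) (K : nat).

Lemma bernoulli_le (h : R) j : 0 <= h -> 1 + j%:R * h <= (1 + h) ^+ j.
Proof.
move=> h0; elim: j => [|j IH]; first by rewrite mul0r addr0 expr0.
rewrite exprS; have h1 : 0 <= 1 + h by rewrite addr_ge0.
apply: le_trans (ler_wpM2l h1 IH); rewrite -natr1.
have : 0 <= j%:R * (h * h) by rewrite !mulr_ge0.
by nra.
Qed.

(** With [w = 1 / (1 + h)], Bernoulli's inequality makes the denominator grow at least linearly in
    [j]. *)
Lemma natmul_geom_bounded w : 0 < w < 1 ->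
  exists2 B, 0 < B & forall j, j.+1%:R * w ^+ j <= B.
Proof.
move=> /andP[w0 w1].
have wV1 : 1 < w^-1 by rewrite invf_gt1.
pose h := w^-1 - 1; have h0 : 0 < h by rewrite subr_gt0.
have hV0 : 0 < h^-1 by rewrite invr_gt0.
exists (1 + h^-1); first by rewrite addr_gt0.
move=> j; have -> : w ^+ j = ((1 + h) ^+ j)^-1.
  by rewrite /h addrC subrK exprVn invrK.
rewrite ler_pdivrMr; last by rewrite exprn_gt0 // addr_gt0.
apply: le_trans (_ : (1 + h^-1) * (1 + j%:R * h) <= _); last first.
  by rewrite ler_wpM2l ?bernoulli_le ?(ltW h0) // addr_ge0 // ltW.
have -> : (1 + h^-1) * (1 + j%:R * h) = j.+1%:R + (h^-1 + j%:R * h).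
  by rewrite -natr1; field; rewrite lt0r_neq0.
by rewrite lerDl addr_ge0 ?(ltW hV0) // mulr_ge0 // ltW.
Qed.

Lemma natmul_geom_divn q K : 0 < q < 1 -> (0 < K)%N ->
  exists2 B, 0 < B &
    exists2 w, 0 < w < 1 & forall r, r%:R * q ^+ (r %/ K) <= B * w ^+ (r %/ K).
Proof.
(* Half of the decay, one of the two factors [w ^+ j] in [q ^+ j], absorbs [r], which is at most
   [K * j.+1]. *)
move=> /andP[q0 q1] K0; pose w := Num.sqrt q.
have w0 : 0 < w by rewrite sqrtr_gt0.
have w1 : w < 1 by rewrite -sqrtr1 ltr_sqrt.
have [|B B0 Bj] := @natmul_geom_bounded w; first by rewrite w0 w1.
exists (K%:R * B); first by rewrite mulr_gt0 ?ltr0n.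
exists w; first by rewrite w0 w1.
move=> r; set j := (r %/ K)%N.
have -> : q ^+ j = w ^+ j * w ^+ j by rewrite -exprMn -expr2 sqr_sqrtr ?ltW.
rewrite mulrA ler_wpM2r ?exprn_ge0 ?(ltW w0) //.
apply: (@le_trans _ _ (K%:R * j.+1%:R * w ^+ j)).
  rewrite ler_wpM2r ?exprn_ge0 ?(ltW w0) // -natrM ler_nat.
  by rewrite mulnC ltnW // ltn_ceil.
by rewrite -mulrA ler_wpM2l.
Qed.

Local Open Scope classical_set_scope.

Lemma cvg_geom_divn w K : 0 < w < 1 -> (0 < K)%N ->
  (w ^+ (r %/ K)) @[r --> \oo] --> 0.
Proof.
move=> /andP[w0 w1] K0.
apply: (@cvg_comp _ _ _ (fun r => r %/ K)%N (fun j => w ^+ j) _ \oo).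
  apply/cvgnyPge => A; near=> r; rewrite leq_divRL //.
  by near: r; exact: nbhs_infty_ge.
by apply: cvg_expr; rewrite ger0_norm // ltW.
Unshelve. all: by end_near. Qed.

Lemma cvg_natmul_geom_divn q K (t : nat) : 0 < q < 1 -> (0 < K)%N ->
  ((r + t)%:R * q ^+ (r %/ K)) @[r --> \oo] --> 0.
Proof.
move=> q01 K0; have [B B0 [w w01 Bw]] := natmul_geom_divn q01 K0.
have /andP[q0 q1] := q01.
apply: (@squeeze_cvgr _ _ _ _ (fun=> 0)
    (fun r => B * w ^+ (r %/ K) + t%:R * q ^+ (r %/ K))).
- near=> r; rewrite mulr_ge0 ?exprn_ge0 ?(ltW q0) //=.
  by rewrite natrD mulrDl lerD2r.
- exact: cvg_cst.
rewrite [X in _ --> X](_ : 0 = B * 0 + t%:R * 0); last by rewrite !mulr0 addr0.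
by apply: cvgD; apply: cvgM; [exact: cvg_cst|exact: cvg_geom_divn
                             |exact: cvg_cst|exact: cvg_geom_divn].
Unshelve. all: by end_near. Qed.

Lemma expr1D_le_expR (x : R) n : 0 <= x -> (1 + x) ^+ n <= expR (n%:R * x).
Proof.
move=> x0; rewrite mulrC expRM_natr lerXn2r ?nnegrE ?expR_ge0 ?addr_ge0 //.
exact: expR_ge1Dx.
Qed.

Lemma cvg_expR0 (f : nat -> R) :
  f r @[r --> \oo] --> 0 -> expR (f r) @[r --> \oo] --> (1 : R).
Proof.
move=> f0; rewrite -[X in _ --> X]expR0.
by apply: (@cvg_comp _ _ _ f expR) f0 _; exact: continuous_expR.
Qed.

(** Each power of [1 + y] is bounded by an exponential. The exponents tend to 0 because
    [r * q ^+ (r %/ K)] does, so the first summand has limit at most 1, and the factor [kap ^+ r]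
    sends the second to 0. *)
Lemma staircase_bound_cvg q K (kap N W : R) (s t : nat) : 0 < q < 1 -> (0 < K)%N ->
  0 < kap < 1 -> 0 <= N -> 0 <= W -> forall A : R, 0 <= A -> forall e : R, 0 < e ->
  \forall c \near \oo,
  (1 + N * q ^+ (c %/ K)) ^+ (c + t) * (1 + q ^+ (c %/ K) * W) ^+ s +
  A * (N ^+ t * (kap + 2 * N * q ^+ (c %/ K)) ^+ c * W ^+ s) <= 1 + e.
Proof.
move=> q01 K0 /andP[k0 k1] N0 W0 A A0 e e0.
have /andP[q0 q1] := q01.
pose x r : R := q ^+ (r %/ K).
have x0 r : 0 <= x r by rewrite exprn_ge0 // ltW.
pose b r := expR (N * ((r + t)%:R * x r)) * expR (s%:R * W * x r) +
  A * N ^+ t * W ^+ s * (kap ^+ r * expR (2 * N / kap * ((r + 0)%:R * x r))).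
have b1 : b r @[r --> \oo] --> (1 : R).
  rewrite [X in _ --> X](_ : (1 : R) = 1 * 1 + A * N ^+ t * W ^+ s * (0 * 1)).
    2: by rewrite mul0r mulr0 addr0 mulr1.
  apply: cvgD.
    apply: cvgM; apply: cvg_expR0.
      by rewrite -(mulr0 N); apply: cvgM; [exact: cvg_cst|exact: cvg_natmul_geom_divn].
    by rewrite -(mulr0 (s%:R * W)); apply: cvgM; [exact: cvg_cst|exact: cvg_geom_divn].
  apply: cvgM; first exact: cvg_cst.
  apply: cvgM.
    by apply: cvg_expr; rewrite ger0_norm // ltW.
  apply: cvg_expR0; rewrite -(mulr0 (2 * N / kap)); apply: cvgM; first exact: cvg_cst.
  exact: cvg_natmul_geom_divn.
have e1 : 1 < 1 + e by rewrite ltrDl.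
have : \forall r \near \oo, b r < 1 + e by exact: cvgr_lt b1 _ e1.
apply: filterS => r /ltW; apply: le_trans.
rewrite -/(x r) /b lerD //.
  rewrite ler_pM ?exprn_ge0 ?addr_ge0 ?mulr_ge0 //.
    apply: le_trans (expr1D_le_expR _ _) _; first by rewrite mulr_ge0.
    by rewrite mulrCA.
  apply: le_trans (expr1D_le_expR _ _) _; first by rewrite mulr_ge0.
  by rewrite -mulrA [W * _]mulrC.
rewrite -!mulrA ler_wpM2l // ler_wpM2l ?exprn_ge0 // mulrC ler_wpM2l ?exprn_ge0 //.
have -> : kap + 2 * (N * x r) = kap * (1 + 2 * N / kap * x r).
  by field; rewrite lt0r_neq0.
have y0 : 0 <= 2 * N / kap * x r by rewrite !mulr_ge0 // invr_ge0 ltW.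
rewrite exprMn ler_wpM2l ?exprn_ge0 ?(ltW k0) //.
apply: le_trans (expr1D_le_expR _ y0) _.
by rewrite addn0 ler_expR le_eqVlt; apply/orP; left; apply/eqP; ring.
Qed.

Lemma staircase_constants q (n : nat) : 0 < q < 1 -> (0 < n)%N ->
  exists u, exists K, exists C,
  [/\ 0 < u <= 1, (0 < K)%N /\ (u^-1) ^+ n <= (1 + u) ^+ K,
    (1 + u * n%:R) * (1 + u) <= 2,
    0 < (1 + u * n%:R) * (1 + u) * (1 - (1 - q) / n%:R) < 1
  & forall r, (1 + 2 * n%:R * q ^+ (r %/ K)) ^+ r <= C].
Proof.
move=> q01 n0; have /andP[q0 q1] := q01.
have N1 : 1 <= n%:R :> R by rewrite -[1]/(1%:R) ler_nat.
have N0 : 0 < n%:R :> R by rewrite ltr0n.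
(* With this choice [u * n = s] and [u <= s], so the loss is at most [(1 + s) ^+ 2]. It is beaten by
   the gain [1 - 4 * s], since [(1 + s) ^+ 2 * (1 - 4 * s) < 1]. *)
pose s := (1 - q) / n%:R / 4; pose u := s / n%:R.
have z0 : 0 < (1 - q) / n%:R by rewrite divr_gt0 // subr_gt0.
have z1 : (1 - q) / n%:R < 1.
  by rewrite ltr_pdivrMr // mul1r; apply: lt_le_trans N1; rewrite gtrBl.
have s0 : 0 < s by rewrite divr_gt0.
have u0 : 0 < u by rewrite divr_gt0.
have us : u <= s by rewrite ler_pdivrMr // ler_peMr // ltW.
have s4 : s < 4^-1 by rewrite /s; move: z1; lra.
have un : u * n%:R = s by rewrite /u divfK // lt0r_neq0.
have zs : (1 - q) / n%:R = 4 * s by rewrite /s; field; rewrite lt0r_neq0.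
(* By Bernoulli [(1 + u) ^+ K] is at least [1 + K * u], so any [K] above [(u^-1) ^+ n / u]
   suffices. *)
pose K := (Num.Def.archi_bound ((u^-1) ^+ n / u)).+1.
have K0 : (0 < K)%N by [].
have [B B0 [w /andP[w0 w1] Bw]] := natmul_geom_divn q01 K0.
exists u, K, (expR (2 * n%:R * B)); split.
- by rewrite u0 (le_trans us) // (le_trans (ltW s4)) //; lra.
- split=> //; apply: le_trans (bernoulli_le _ (ltW u0)).
  rewrite -lerBlDl -ler_pdivrMr //.
  apply: (@le_trans _ _ ((u^-1) ^+ n / u)).
    by rewrite ler_wpM2r ?invr_ge0 ?(ltW u0) // gerBl.
  apply: ltW; apply: lt_trans (archi_boundP _) _; last by rewrite ltr_nat.
  by rewrite divr_ge0 ?exprn_ge0 ?invr_ge0 ?(ltW u0).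
- by rewrite un; move: us s4 s0 u0; nra.
- rewrite un zs; apply/andP; split.
    by rewrite !mulr_gt0 //; [rewrite addr_gt0|rewrite addr_gt0|lra].
  apply: (@le_lt_trans _ _ ((1 + s) * (1 + s) * (1 - 4 * s))).
    rewrite ler_wpM2r //; first by lra.
    by rewrite ler_wpM2l ?lerD2l // addr_ge0 // ltW.
  by nra.
move=> r; apply: le_trans (expr1D_le_expR _ _) _.
  by rewrite !mulr_ge0 ?exprn_ge0 // ltW.
rewrite ler_expR mulrCA ler_wpM2l ?mulr_ge0 ?(ltW N0) //.
by apply: (le_trans (Bw r)); rewrite ler_piMr ?(ltW B0) // exprn_ile1 ?ltW.
Qed.

End Asymptotics.

(** The threshold [c0] is chosen before the index sets and the pattern: the bound sees only [c],
    [t], [#|L|], [#|X|] and [q], so one [c] serves all matrix sizes. *)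
Lemma avg_staircase_cvg (R : realType) (Gam X : finType) (nz : X -> Gam -> bool)
    (x0 : X) (q : R) (L : finType) (t : nat) (e : R) :
  (0 < #|Gam|)%N -> (forall g, nz x0 g = false) ->
  (forall A : {set X}, (#|A| * #|annihilator nz A| <= #|Gam|)%N) ->
  0 < q < 1 -> 0 < e -> exists c0, forall c, (c0 <= c)%N ->
  forall (I J : finType) (free : I -> J -> bool) (R0 : {set I}) (S : {set J})
    (lam : I -> L) (mu : J -> L), #|R0| = c -> #|S| = (c + t)%N ->
  (forall y, #|[set i | (i \notin R0) && (lam i == y)]%SET| =
             #|[set j | (j \notin S) && (mu j == y)]%SET|) ->
  (forall i j, j \in S -> free i j) ->
  (forall i j, i \in R0 -> free i j) ->
  (forall i j, j \notin S -> lam i = mu j -> free i j) ->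
  forall gen : pred {ffun I -> Gam},
  (forall F, gen F -> forall chi, chi != x0 -> exists i, nz chi (F i)) ->
  avg (fun F => (gen F)%:R * \prod_j column_weight nz q free F j) <= 1 + e.
Proof.
move=> G0 nzx perp q01 e0.
have X0 : (0 < #|X|)%N by apply/card_gt0P; exists x0.
have [u [K [C [u01 [K0 uK] tau2 /andP[k0 k1] Cb]]]] := staircase_constants q01 X0.
have C0 : 0 <= C by apply: le_trans (Cb 0); rewrite expr0.
have [c0 _ Hc0] := staircase_bound_cvg #|L| t q01 K0
  (introT andP (conj k0 k1)) (ler0n _ #|X|) (weight_bound_ge0 Cb)
  (ler0n _ (2 ^ #|X|)) e0.
exists c0 => c /Hc0 /= bc I J free R0 S lam mu cR0.
move: bc; rewrite -cR0 => bc cS cb fS fR fb gen genP.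
apply: le_trans bc.
exact: (avg_staircase G0 nzx perp q01 u01 uK tau2 (ltW k1) Cb cS cb fS fR fb genP).
Qed.

(** * Characters of a finite abelian group *)

(** The polynomial [X^n - 1] is separable, so it has [n] distinct roots, and these contain a
    generator. The statement is needed over [R[i]]. *)
Lemma prim_root_exists (C : closedFieldType) n :
  n%:R != 0 :> C -> exists z : C, n.-primitive_root z.
Proof.
move=> nC; have n_gt0 : (0 < n)%N by case: n nC => //; rewrite eqxx.
have [r] := closed_field_poly_normal ('X^n - 1 : {poly C}).
rewrite (monicP _) ?monicXnsubC // scale1r => Dp.
have rn1 : all n.-unity_root r by apply/allP => z; rewrite -root_prod_XsubC -Dp.
have sz_r : (n < (size r).+1)%N by rewrite -(size_prod_XsubC r id) -Dp size_XnsubC.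
have [|z _ zP] := hasP (has_prim_root n_gt0 rn1 _ sz_r); last by exists z.
by rewrite -separable_prod_XsubC -Dp separable_Xn_sub_1.
Qed.

(** The inverse of [1 + s] replaces a minimum: it lies below every value and is at most 1 even if
    [P] is empty. *)
Lemma finite_pos_lower_bound (F : numFieldType) (T : finType) (P : pred T) (f : T -> F) :
  (forall x, P x -> 0 < f x) ->
  exists2 eta, 0 < eta <= 1 & forall x, P x -> eta <= f x.
Proof.
move=> fP; set s := \sum_(x | P x) (f x)^-1.
have s0 : 0 <= s by apply: sumr_ge0 => x /fP f0; rewrite invr_ge0 ltW.
have s1 : 0 < 1 + s by rewrite ltr_pwDl // ltr01.
exists (1 + s)^-1.
  by rewrite invr_gt0 s1 /= invf_le1 // lerDl.
move=> x Px; have fx := fP x Px.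
rewrite -[f x]invrK lef_pV2 ?posrE ?invr_gt0 //.
rewrite /s (bigD1 x) //= addrCA lerDl addr_ge0 // sumr_ge0 // => y /andP[Py _].
by rewrite invr_ge0 ltW // fP.
Qed.

Section UnitCharacter.
Variables (a : nat) (C : numClosedFieldType) (z : C).
Hypothesis a_gt1 : (1 < a)%N.
Hypothesis z_prim : a.-primitive_root z.
Implicit Types x y : 'Z_a.

Let z_prim' : (Zp_trunc a).+2.-primitive_root z. Proof. by rewrite Zp_cast. Qed.

Definition ez x : C := z ^+ x.

Lemma ez0 : ez 0 = 1. Proof. by rewrite /ez expr0. Qed.

Lemma ezD x y : ez (x + y) = ez x * ez y.
Proof. by rewrite /ez /= (prim_expr_mod z_prim') exprD. Qed.

Lemma norm_ez x : `|ez x| = 1.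
Proof.
rewrite normrX (_ : `|z| = 1) ?expr1n //; apply/eqP.
by rewrite -(pexpr_eq1 (ltnW a_gt1)) // -normrX prim_expr_order // normr1.
Qed.

Lemma ez_neq0 x : ez x != 0. Proof. by rewrite -normr_eq0 norm_ez oner_eq0. Qed.

Lemma ezN x : ez (- x) = (ez x)^*.
Proof.
apply: (mulfI (ez_neq0 x)); rewrite -ezD subrr ez0 -normCK norm_ez.
by rewrite expr1n.
Qed.

Lemma ez_eq1 x : (ez x == 1) = (x == 0).
Proof.
rewrite /ez -(expr0 z) (eq_prim_root_expr z_prim') mod0n modn_small //.
Qed.

Lemma ez_sum (I : finType) (P : pred I) (f : I -> 'Z_a) :
  ez (\sum_(i | P i) f i) = \prod_(i | P i) ez (f i).
Proof. exact: (big_morph ez ezD ez0). Qed.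

Lemma sqr_norm_1B_ez x : `|1 - ez x| ^+ 2 = 2 - (ez x + ez (- x)).
Proof.
rewrite normCK rmorphB rmorph1 /= -ezN mulrBl !mulrBr mul1r mulr1 mul1r.
by rewrite -ezD subrr ez0; ring.
Qed.

(* With X, X' independent copies, 1 - |E e(Xy)|^2 = E |1 - e((X - X')y)|^2 / 2. *)
Lemma char_fun_bound (eps : C) : 0 < eps <= 1 ->
  exists2 eta : C, 0 < eta <= 1 &
  forall (mu : 'Z_a -> C) y, (forall x, 0 <= mu x) -> \sum_x mu x = 1 ->
    (forall r, \sum_(x | (x - r) * y == 0) mu x <= 1 - eps) ->
    `|\sum_x mu x * ez (x * y)| ^+ 2 <= 1 - eta * eps.
Proof.
move=> /andP[e0 e1].
have [x|eta /andP[eta0 eta1] etaP] := @finite_pos_lower_bound C 'Z_a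
    [pred x | x != 0] (fun x => `|1 - ez x| ^+ 2 / 2).
  rewrite /= -ez_eq1 => x1; rewrite divr_gt0 ?ltr0n // exprn_gt0 // normr_gt0.
  by rewrite subr_eq0 eq_sym.
exists eta; first by rewrite eta0.
move=> mu y mu0 mu1 bal; set S := \sum_x _.
pose d x x' : C := ez ((x - x') * y).
have SE : `|S| ^+ 2 = \sum_x' \sum_x mu x' * mu x * d x x'.
  rewrite normCK rmorph_sum mulr_sumr; apply: eq_bigr => x' _.
  rewrite mulr_suml; apply: eq_bigr => x _.
  rewrite rmorphM /= -ezN (CrealP (ger0_real (mu0 x'))) /d mulrBl ezD.
  by ring.
(* Exchanging the two copies supplies the conjugate terms, so that the half-sum of both forms
   involves only real parts. *)
have SE' : `|S| ^+ 2 = \sum_x' \sum_x mu x' * mu x * d x' x.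
  rewrite SE exchange_big /=; apply: eq_bigr => x' _; apply: eq_bigr => x _.
  by rewrite [mu x * _]mulrC.
have one : 1 = \sum_x' \sum_x mu x' * mu x.
  under eq_bigr do rewrite -mulr_sumr mu1 mulr1.
  by rewrite mu1.
have key : \sum_x' \sum_x mu x' * mu x * (`|1 - d x x'| ^+ 2 / 2) =
    1 - `|S| ^+ 2.
  have -> : 1 - `|S| ^+ 2 = (\sum_x' \sum_x mu x' * mu x +
      \sum_x' \sum_x mu x' * mu x - (\sum_x' \sum_x mu x' * mu x * d x x' +
      \sum_x' \sum_x mu x' * mu x * d x' x)) / 2.
    by rewrite -one -SE -SE'; field.
  rewrite -!big_split -sumrB mulr_suml; apply: eq_bigr => x' _ /=.
  rewrite -!big_split -sumrB mulr_suml; apply: eq_bigr => x _ /=.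
  by rewrite /d sqr_norm_1B_ez -mulNr opprB; field.
have -> : (`|S| ^+ 2 <= 1 - eta * eps) = (eta * eps <= 1 - `|S| ^+ 2).
  by rewrite lerBrDl -lerBrDr.
rewrite -key.
have -> : eta * eps = \sum_x' mu x' * (eta * eps) by rewrite -mulr_suml mu1 mul1r.
apply: ler_sum => x' _.
under eq_bigr do rewrite -mulrA.
rewrite -mulr_sumr ler_wpM2l //.
(* The [x] with [(x - x') * y = 0] are dropped. By the balance hypothesis at [r = x'] the remaining
   ones have mass at least [eps], and for them [etaP] applies. *)
rewrite (bigID (fun x => (x - x') * y == 0)) /=.
rewrite -[X in X <= _]add0r lerD //.
  by apply: sumr_ge0 => x _; rewrite mulr_ge0 // divr_ge0 // exprn_ge0.
apply: (@le_trans _ _ (\sum_(x | (x - x') * y != 0) mu x * eta)); last first.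
  by apply: ler_sum => x nz; rewrite ler_wpM2l // etaP.
rewrite -mulr_suml [eta * _]mulrC ler_wpM2r ?(ltW eta0) //.
move: mu1; rewrite (bigID (fun x => (x - x') * y == 0)) /= => mu1.
by rewrite -(lerD2l (1 - eps)) subrK -[X in X <= _]mu1 lerD2r.
Qed.

End UnitCharacter.

(** * The dual group with values in Z/a *)

Section Dual.
Variables (a : nat) (Gam : finGroupType).
Hypothesis a_gt1 : (1 < a)%N.
Hypothesis Gam_abelian : abelian [set: Gam].
Hypothesis Gam_exp : forall x : Gam, (x ^+ a = 1)%g.

Definition is_zchar (f : {ffun Gam -> 'Z_a}) :=
  [forall x, forall y, f (x * y)%g == f x + f y].
(** As the exponent of [Gam] divides [a], homomorphisms to ['Z_a] already give the whole dual;
    composing with [ez] turns them into complex characters. *)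
Definition zdual := {f : {ffun Gam -> 'Z_a} | is_zchar f}.
Definition zdual_fun (chi : zdual) : Gam -> 'Z_a := val chi.
Coercion zdual_fun : zdual >-> Funclass.
Implicit Types chi psi : zdual.

Lemma zdualM chi x y : chi (x * y)%g = chi x + chi y.
Proof. by have /forallP/(_ x)/forallP/(_ y)/eqP := valP chi. Qed.

Lemma zdual1 chi : chi 1%g = 0.
Proof. by apply: (@addrI _ (chi 1%g)); rewrite -zdualM mulg1 addr0. Qed.

Lemma zdualX chi x n : chi (x ^+ n)%g = chi x *+ n.
Proof. by elim: n => [|n IH]; rewrite ?expg0 ?zdual1 // expgS zdualM IH mulrS. Qed.

Lemma zdual_ext chi psi : chi =1 psi -> chi = psi.
Proof. by move=> e; apply/val_inj/ffunP. Qed.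

Lemma zdual0_subproof : is_zchar [ffun=> 0].
Proof. by apply/forallP => x; apply/forallP => y; rewrite !ffunE addr0. Qed.
Definition zdual0 : zdual := exist (fun f => is_zchar f) _ zdual0_subproof.

Lemma zdual0E x : zdual0 x = 0. Proof. by rewrite /zdual_fun ffunE. Qed.

Lemma zdual_sub_subproof chi psi : is_zchar [ffun x => chi x - psi x].
Proof.
apply/forallP => x; apply/forallP => y; rewrite !ffunE !zdualM opprD.
by rewrite addrACA.
Qed.
Definition zdual_sub chi psi : zdual := exist (fun f => is_zchar f) _ (zdual_sub_subproof chi psi).

Lemma zdual_subE chi psi x : zdual_sub chi psi x = chi x - psi x.
Proof. by rewrite /zdual_fun ffunE. Qed.

(** The irreducible complex characters have trivial common kernel. In the abelian case they are
    linear with values among the [a]-th roots of unity, so the exponent with respect to a primitive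
    root [w] is a homomorphism to ['Z_a]. *)
Lemma zdual_separates x : x != 1%g -> exists chi : zdual, chi x != 0.
Proof.
move=> x1; have [w w_prim] := C_prim_root_exists (ltnW a_gt1).
have w_prim' : (Zp_trunc a).+2.-primitive_root w by rewrite Zp_cast.
pose G := [set: Gam]%G.
have [i xi] : exists i : Iirr G, x \notin cfker 'chi_i.
  apply/existsP; rewrite -negb_forall; apply: contra x1 => /forallP xk.
  have : x \in \bigcap_(i : Iirr G) cfker 'chi_i by apply/bigcapP.
  by rewrite TI_cfker_irr inE.
have lin : 'chi_i \is a linear_char by apply/char_abelianP.
have root y : 'chi_i y ^+ a = 1.
  by rewrite -lin_charX ?inE // Gam_exp lin_char1.
pose f : {ffun Gam -> 'Z_a} := [ffun y => inZp (sval (prim_rootP w_prim (root y)))].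
have fE y : w ^+ f y = 'chi_i y.
  rewrite ffunE /= (prim_expr_mod w_prim').
  by case: (prim_rootP _ _) => k /= ->.
have winj : injective (fun k : 'Z_a => w ^+ k).
  move=> k l /eqP; rewrite (eq_prim_root_expr w_prim').
  by rewrite !modn_small // => /eqP/val_inj.
have fP : is_zchar f.
  apply/forallP => y; apply/forallP => y'; apply/eqP/winj.
  by rewrite fE /= (prim_expr_mod w_prim') exprD !fE lin_charM ?inE.
exists (exist (fun f => is_zchar f) f fP); apply: contra xi => /eqP fx0.
by rewrite cfkerEirr inE lin_char1 // -fE (fx0 : f x = 0).
Qed.

Variables (C : numClosedFieldType) (z : C).
Hypothesis z_prim : a.-primitive_root z.
Local Notation ez := (ez z).

Lemma sum_zdual x : \sum_(chi : zdual) ez (chi x) = #|{: zdual}|%:R * (x == 1%g)%:R.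
Proof.
case: eqVneq => [->|/zdual_separates[psi px]].
  rewrite (eq_bigr (fun=> 1)) => [|chi _]; last by rewrite zdual1 ez0.
  by rewrite sumr_const mulr1.
rewrite mulr0; set S := \sum_chi _.
have sub_inj : injective (fun chi => zdual_sub chi psi).
  move=> chi chi' e; apply: zdual_ext => y.
  by apply: (addIr (- psi y)); rewrite -!zdual_subE e.
have : S = S * ez (- psi x).
  rewrite {1}/S (reindex_inj sub_inj) mulr_suml; apply: eq_bigr => chi _ /=.
  by rewrite zdual_subE (ezD a_gt1 z_prim).
move/eqP; rewrite -subr_eq0 -{1}[S]mulr1 -mulrBr mulf_eq0 => /orP[/eqP //|].
by rewrite subr_eq0 eq_sym (ez_eq1 a_gt1 z_prim) oppr_eq0 (negbTE px).
Qed.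

Lemma sum_zdual_arg chi : \sum_x ez (chi x) = #|Gam|%:R * (chi == zdual0)%:R.
Proof.
case: eqVneq => [->|cx].
  rewrite (eq_bigr (fun=> 1)) => [|x _]; last by rewrite zdual0E ez0.
  by rewrite sumr_const mulr1.
have [y cy] : exists y, chi y != 0.
  apply/existsP; rewrite -negb_forall; apply: contra cx => /forallP c0.
  by apply/eqP/zdual_ext => y; rewrite zdual0E; apply/eqP.
rewrite mulr0; set S := \sum_x _.
have : S = ez (chi y) * S.
  rewrite {1}/S (reindex_inj (mulgI y)) mulr_sumr; apply: eq_bigr => x _ /=.
  by rewrite zdualM (ezD a_gt1 z_prim).
move/eqP; rewrite -subr_eq0 -{1}[S]mul1r -mulrBl mulf_eq0 => /orP[|/eqP//].
by rewrite subr_eq0 eq_sym (ez_eq1 a_gt1 z_prim) (negbTE cy).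
Qed.

(** Summing [ez (chi x)] over all pairs in the two orders leaves [#|zdual|] on one side and [#|Gam|]
    on the other. *)
Lemma card_zdual : #|{: zdual}| = #|Gam|.
Proof.
have : \sum_x \sum_(chi : zdual) ez (chi x) = \sum_(chi : zdual) \sum_x ez (chi x).
  by rewrite exchange_big.
under eq_bigr do rewrite sum_zdual.
under [in RHS]eq_bigr do rewrite sum_zdual_arg.
rewrite -!mulr_sumr (bigD1 1%g) //= eqxx big1 => [|x /negbTE -> //].
rewrite (bigD1 zdual0) //= eqxx big1 => [|chi /negbTE -> //].
by rewrite !addr0 !mulr1 => /eqP; rewrite eqr_nat => /eqP.
Qed.

Definition zdual_nz (chi : zdual) (x : Gam) := chi x != 0.

(* Parseval for the sum of the characters in A, which equals #|A| on the
   annihilator. *)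
Lemma card_zdual_annihilator (A : {set zdual}) :
  (#|A| * #|annihilator zdual_nz A| <= #|Gam|)%N.
Proof.
have [->|A0] := eqVneq A set0; first by rewrite cards0.
pose f x : C := \sum_(chi in A) ez ((chi : zdual) x).
have E (chi psi : zdual) : \sum_x ez (chi x) * (ez (psi x))^* =
    #|Gam|%:R * (chi == psi)%:R.
  transitivity (\sum_x ez (zdual_sub chi psi x)).
    apply: eq_bigr => x _.
    by rewrite zdual_subE (ezD a_gt1 z_prim) (ezN a_gt1 z_prim).
  rewrite sum_zdual_arg; congr (_ * (nat_of_bool _)%:R).
  apply/eqP/eqP => [e|->]; apply: zdual_ext => x.
    by apply/eqP; rewrite -subr_eq0 -zdual_subE e zdual0E.
  by rewrite zdual_subE zdual0E subrr.
have parseval : \sum_x `|f x| ^+ 2 = #|A|%:R * #|Gam|%:R.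
  under eq_bigr do rewrite normCK rmorph_sum mulr_sumr.
  rewrite exchange_big /=.
  transitivity (\sum_(psi in A) (#|Gam|%:R : C)); last first.
    by rewrite sumr_const mulr_natl.
  apply: eq_bigr => psi pA.
  under eq_bigr do rewrite mulr_suml.
  rewrite exchange_big (bigD1 psi) //=.
  rewrite E eqxx mulr1 big1 ?addr0 // => chi /andP[_ /negbTE cp].
  by rewrite E cp mulr0.
have : \sum_(x in annihilator zdual_nz A) `|f x| ^+ 2 <= #|A|%:R * #|Gam|%:R.
  rewrite -parseval [X in _ <= X](bigID (mem (annihilator zdual_nz A))) /= lerDl.
  by apply: sumr_ge0 => x _; rewrite exprn_ge0.
rewrite (eq_bigr (fun=> #|A|%:R ^+ 2)) => [|x]; last first.
  rewrite inE => /forall_inP xA; rewrite /f (eq_bigr (fun=> 1)) => [|chi /xA].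
    by rewrite sumr_const normr_nat.
  by rewrite negbK => /eqP ->; rewrite ez0.
rewrite sumr_const -[X in X <= _]mulr_natl -natrX -!natrM ler_nat expnS expn1.
by rewrite mulnC -mulnA leq_mul2l cards_eq0 (negbTE A0).
Qed.

Lemma zdual_generated (I : finType) (F : I -> Gam) :
  <<F @: I>>%g = [set: Gam] -> forall chi, chi != zdual0 ->
  exists i, zdual_nz chi (F i).
Proof.
move=> genF chi c0; apply/existsP; rewrite -negb_forall.
apply: contra c0 => /forallP nz0.
have kerG : group_set [set x | chi x == 0].
  apply/group_setP; split; first by rewrite inE zdual1.
  by move=> x y; rewrite !inE zdualM => /eqP -> /eqP ->; rewrite addr0.
have : <<F @: I>>%g \subset Group kerG.
  rewrite gen_subG; apply/subsetP => _ /imsetP[i _ ->].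
  by rewrite inE; have := nz0 i; rewrite /zdual_nz; case: eqP.
rewrite genF => /subsetP kerT; apply/eqP/zdual_ext => x.
by have := kerT x (in_setT x); rewrite inE zdual0E => /eqP.
Qed.

End Dual.

(** * Probability of the relations *)

(** Both differences of products telescope by the same identity, and [|p j| <= l j] lets the terms
    be compared one by one. The induction carries the sign of the product of the [b j] along. *)
Lemma prod_dist_le (F : numDomainType) (J : finType) (p b l : J -> F) :
  (forall j, 0 <= b j) -> (forall j, `|p j - b j| <= l j - b j) ->
  `|\prod_j p j - \prod_j b j| <= \prod_j l j - \prod_j b j.
Proof.
move=> b0 pl.
have pl' j : `|p j| <= l j.
  rewrite -(subrK (b j) (p j)); apply: le_trans (ler_normD _ _) _.
  by rewrite -[l j](subrK (b j)) lerD // ger0_norm.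
have l0 j : 0 <= l j by apply: le_trans (pl' j).
suff [] : 0 <= \prod_j b j /\
  `|\prod_j p j - \prod_j b j| <= \prod_j l j - \prod_j b j by [].
elim: (index_enum J) => [|j s [B0 IH]]; first by rewrite !big_nil subrr normr0.
rewrite !big_cons; move: B0 IH.
set P := \prod_(j <- s) p j; set B := \prod_(j <- s) b j.
set L := \prod_(j <- s) l j => B0 IH.
split; first by rewrite mulr_ge0.
have -> : p j * P - b j * B = p j * (P - B) + (p j - b j) * B by ring.
have -> : l j * L - b j * B = l j * (L - B) + (l j - b j) * B by ring.
apply: le_trans (ler_normD _ _) _; rewrite !normrM lerD ?ler_pM //.
by rewrite (ger0_norm B0).
Qed.

Section Relations.
Variables (R : rcfType) (a : nat) (Gam : finGroupType) (I J : finType).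
Hypothesis a_gt1 : (1 < a)%N.
Hypothesis Gam_abelian : abelian [set: Gam].
Hypothesis Gam_exp : forall x : Gam, (x ^+ a = 1)%g.
Local Notation C := (R[i]%C : numClosedFieldType).
Local Notation zdual := (zdual a Gam).

Definition relation (F : {ffun I -> Gam}) (m : {ffun I * J -> 'Z_a}) (j : J) :=
  (\prod_i F i ^+ m (i, j) == 1)%g.

Lemma zdual_relation (chi : zdual) F (m : {ffun I * J -> 'Z_a}) j :
  chi (\prod_i F i ^+ m (i, j))%g = \sum_i m (i, j) * chi (F i).
Proof.
rewrite (big_morph chi (zdualM chi) (zdual1 chi)); apply: eq_bigr => i _.
by rewrite zdualX -mulr_natl natr_Zp.
Qed.

Variable mu : I * J -> 'Z_a -> R.

Definition matrix_law (m : {ffun I * J -> 'Z_a}) : R := \prod_p mu p (m p).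

Definition prob_relations F : R :=
  \sum_m matrix_law m * [forall j, relation F m j]%:R.

Variable z : C.
Hypothesis z_prim : a.-primitive_root z.

Definition char_fun p (y : 'Z_a) : C := \sum_x (mu p x)%:C%C * ez z (x * y).

(** In each column the indicator of the relation is the mean of the characters of its left side.
    Distributivity turns the product over columns into a sum over choices [c] of one character per
    column; for each choice the sum over matrices factors over the entries, by independence. *)
Lemma prob_relations_fourier F :
  (prob_relations F)%:C%C =
  \prod_j (#|Gam|%:R^-1 * \sum_(chi : zdual) \prod_i char_fun (i, j) (chi (F i))).
Proof.
have N0 : #|Gam|%:R != 0 :> C by rewrite pnatr_eq0 -lt0n; apply/card_gt0P; exists 1%g.
have relE m : [forall j, relation F m j]%:R = \prod_j (#|Gam|%:R^-1 *
    \sum_(chi : zdual) \prod_i ez z (m (i, j) * chi (F i))) :> C.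
  transitivity (\prod_j ((relation F m j)%:R : C)).
    case: (boolP [forall j, _]) => [/forallP r|].
      by rewrite big1 // => j _; rewrite r.
    rewrite negb_forall => /existsP[j /negbTE rj].
    by rewrite (bigD1 j) //= rj mul0r.
  apply: eq_bigr => j _.
  under eq_bigr do rewrite -(ez_sum a_gt1 z_prim) -zdual_relation.
  rewrite (sum_zdual a_gt1 Gam_abelian Gam_exp z_prim).
  by rewrite (card_zdual a_gt1 Gam_abelian Gam_exp z_prim) mulKf.
rewrite /prob_relations rmorph_sum /=.
under eq_bigr do rewrite rmorphM /= rmorph_nat relE big_split /= bigA_distr_bigA /=
  mulrCA mulr_sumr.
rewrite -mulr_sumr exchange_big /= [RHS]big_split /=; congr (_ * _).
rewrite [RHS]bigA_distr_bigA /=; apply: eq_bigr => c _.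
transitivity (\prod_p char_fun p ((c p.2 : zdual) (F p.1))); last first.
  by rewrite exchange_big pair_bigA; apply: eq_bigr => -[].
rewrite bigA_distr_bigA; apply: eq_bigr => m _.
rewrite rmorph_prod /= exchange_big pair_bigA -big_split /=.
by apply: eq_bigr => -[].
Qed.

Variables (q : R) (free : I -> J -> bool).
Hypothesis mu_ge0 : forall p x, 0 <= mu p x.
Hypothesis mu_sum : forall p, \sum_x mu p x = 1.
Hypothesis char_fun_le : forall i j y, free i j -> y != 0 ->
  `|char_fun (i, j) y| <= q%:C%C.

Lemma char_fun_le1 p y : `|char_fun p y| <= 1.
Proof.
apply: le_trans (ler_norm_sum _ _ _) _.
rewrite (eq_bigr (fun x => (mu p x)%:C%C)) => [|x _].
  by rewrite -rmorph_sum mu_sum rmorph1.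
by rewrite normrM (norm_ez a_gt1 z_prim) mulr1 ger0_norm // ler0c.
Qed.

Lemma char_fun0 p : char_fun p 0 = 1.
Proof.
rewrite /char_fun; under eq_bigr do rewrite mulr0 ez0 mulr1.
by rewrite -rmorph_sum mu_sum rmorph1.
Qed.

(** In each column the trivial character gives exactly [1 / #|Gam|]. The others are bounded entry by
    entry, by [q] at a free entry with nonzero character value and by 1 elsewhere, and
    [prod_dist_le] combines the columns. *)
Lemma prob_relations_dist F :
  `|prob_relations F - #|Gam|%:R ^- #|J| | <=
  #|Gam|%:R ^- #|J| * \prod_j column_weight (@zdual_nz a Gam) q free F j
  - #|Gam|%:R ^- #|J|.
Proof.
set N : C := #|Gam|%:R.
have N0 : 0 <= N^-1 by rewrite invr_ge0.
pose w j := column_weight (@zdual_nz a Gam) q free F j.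
have key : `|(prob_relations F)%:C%C - \prod_(j : J) N^-1| <=
    \prod_j (N^-1 * (w j)%:C%C) - \prod_(j : J) N^-1 :> C.
  rewrite prob_relations_fourier; apply: prod_dist_le => // j.
  rewrite (bigD1 (zdual0 a Gam)) //=.
  have -> : \prod_i char_fun (i, j) (zdual0 a Gam (F i)) = 1.
    by rewrite big1 // => i _; rewrite zdual0E char_fun0.
  rewrite mulrDr mulr1 addrAC subrr add0r normrM (ger0_norm N0).
  rewrite -[X in _ - X]mulr1 -mulrBr ler_wpM2l //.
  have -> : w j = 1 + \sum_(chi : zdual | chi != zdual0 a Gam)
      q ^+ #|[set i | free i j && zdual_nz chi (F i)]|.
    rewrite /w /column_weight (bigD1 (zdual0 a Gam)) //=; congr (_ + _).
    rewrite (_ : #|_| = 0%N) //.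
    by apply: eq_card0 => i; rewrite !inE /zdual_nz zdual0E eqxx andbF.
  rewrite rmorphD rmorph1 addrAC subrr add0r rmorph_sum /=.
  apply: le_trans (ler_norm_sum _ _ _) _; apply: ler_sum => chi _.
  rewrite normr_prod rmorphXn /= -prodr_const [X in _ <= X]big_mkcond /=.
  apply: ler_prod => i _; rewrite normr_ge0 inE /=.
  case: ifP => [/andP[fr nz]|_]; last exact: char_fun_le1.
  exact: char_fun_le.
have NE : \prod_(j : J) N^-1 = (#|Gam|%:R ^- #|J|)%:C%C.
  rewrite prodr_const (eq_card (B := J)) // /N -(rmorph_nat (real_complex R)).
  by rewrite -fmorphV -rmorphXn /= exprVn.
move: key; rewrite big_split /= NE -rmorph_prod /= -rmorphM -!rmorphB /=.
by rewrite normc_def /= expr0n /= addr0 sqrtr_sqr lecR.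
Qed.

End Relations.

(** * Random families generate the group *)

Section Generation.
Variables (R : realFieldType) (Gam : finGroupType) (I : finType).

Definition generates (F : {ffun I -> Gam}) := (<<F @: I>>%g == [set: Gam]).

Lemma avg_generates :
  1 - (2 ^ #|Gam|)%:R * 2^-1 ^+ #|I| <= avg (fun F => (generates F)%:R) :> R.
Proof.
have N_gt0 : (0 < #|Gam|)%N by apply/card_gt0P; exists 1%g.
have N0 : 0 < #|Gam|%:R :> R by rewrite ltr0n.
(* Union bound: a family that does not generate lies in a proper subgroup [H], which has index at
   least 2, so this has probability at most [2^-1 ^+ #|I|]. There are at most [2 ^ #|Gam|] such
   [H]. *)
pose P (H : {set Gam}) := group_set H && (H != [set: Gam]).
have h (F : {ffun I -> Gam}) :
    1 <= (generates F)%:R + \sum_(H | P H) \prod_i (F i \in H)%:R :> R.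
  have s0 : 0 <= \sum_(H | P H) \prod_i (F i \in H)%:R :> R.
    by apply: sumr_ge0 => H _; apply: prodr_ge0 => i _.
  case: (boolP (generates F)) => [_|ng]; first by rewrite lerDl.
  rewrite add0r (bigD1 <<F @: I>>%g) /=; last by rewrite /P groupP.
  rewrite big1 => [|i _]; last by rewrite mem_gen ?imset_f.
  by rewrite lerDl; apply: sumr_ge0 => H _; apply: prodr_ge0 => i _.
have := avg_le h; rewrite avg_cst // avgD avg_sum -lerBlDr; apply: le_trans.
rewrite lerD2l lerN2.
apply: (@le_trans _ _ (\sum_(H : {set Gam} | P H) 2^-1 ^+ #|I|)); last first.
  rewrite sumr_const -[_ *+ _]mulr_natl ler_wpM2r ?exprn_ge0 ?invr_ge0 // ler_nat.
  rewrite -cardsT -card_powerset; apply: subset_leq_card.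
  by apply/subsetP => A _; rewrite inE subsetT.
apply: ler_sum => H /andP[gH HT].
rewrite (avg_prod (fun _ x => (x \in H)%:R)) prodr_const (eq_card (B := I)) //.
rewrite lerXn2r ?nnegrE ?mulr_ge0 ?invr_ge0 ?sumr_ge0 ?(ltW N0) //.
rewrite ler_pdivrMl // ler_pdivlMr //.
have -> : \sum_(x : Gam) (x \in H)%:R = #|H|%:R :> R.
  by rewrite -sum1_card natr_sum [RHS]big_mkcond; apply: eq_bigr => x _; case: ifP.
rewrite -natrM ler_nat.
have HsubT : Group gH \subset [set: Gam]%G by apply: subsetT.
have := Lagrange HsubT; rewrite cardsT /= => <-.
rewrite leq_mul2l; apply/orP; right; rewrite (_ : (1 < _)%N = (1 < #|[set: Gam] : Group gH|%g)%N) //.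
by rewrite indexg_gt1 subTset HT.
Qed.

End Generation.

(** * Surjections from a cokernel *)

Section CokernelSurjections.
Variables (a n m : nat) (gT : finGroupType) (G : {group gT}).
Hypothesis a_gt1 : (1 < a)%N.
Hypothesis G_abelian : abelian G.
Hypothesis G_exp : (exponent G %| a)%N.
Local Notation Gam := (subg_of G).
Local Notation V := 'cV['Z_a]_n.
Implicit Types (F : {ffun 'I_n -> Gam}) (u v : V) (M : 'M['Z_a]_(n, m)).

Lemma subg_commute (x y : Gam) : (x * y = y * x)%g.
Proof.
apply: val_inj => /=; apply: (centsP G_abelian); exact: subgP.
Qed.

Lemma subg_expg (x : Gam) : (x ^+ a = 1)%g.
Proof.
apply: val_inj; rewrite -[LHS]/(sgval _) morphX ?inE //=.
by apply: (exponentP G_exp); exact: subgP.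
Qed.

Lemma subg_abelian : abelian [set: Gam].
Proof. by apply/centsP => x _ y _; exact: subg_commute. Qed.

Lemma prodgM (I : Type) (s : seq I) (f g : I -> Gam) :
  (\prod_(i <- s) (f i * g i) = \prod_(i <- s) f i * \prod_(i <- s) g i)%g.
Proof.
elim: s => [|i s IH]; first by rewrite !big_nil mulg1.
rewrite !big_cons IH -!mulgA; congr (_ * _)%g.
by rewrite !mulgA; congr (_ * _)%g; exact: subg_commute.
Qed.

Lemma expg_Zp (x : Gam) (k : nat) : (x ^+ (k %% (Zp_trunc a).+2) = x ^+ k)%g.
Proof. by rewrite Zp_cast // expg_mod // subg_expg. Qed.

(** The homomorphism from column vectors to [G] sending the basis vectors to the [F i]; it is
    additive because the exponent of [G] divides [a]. *)
Definition vec_hom F v : Gam := (\prod_i F i ^+ v i 0%R)%g.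

Lemma vec_homD F u v : vec_hom F (u + v) = (vec_hom F u * vec_hom F v)%g.
Proof.
rewrite /vec_hom -prodgM; apply: eq_bigr => i _.
by rewrite mxE /= expg_Zp expgD.
Qed.

Lemma vec_hom0 F : vec_hom F 0 = 1%g.
Proof. by rewrite /vec_hom big1 // => i _; rewrite mxE expg0. Qed.

Lemma vec_hom_sum F (I : finType) (f : I -> V) :
  vec_hom F (\sum_i f i) = (\prod_i vec_hom F (f i))%g.
Proof. exact: (big_morph _ (vec_homD F) (vec_hom0 F)). Qed.

Lemma vec_homMn F v k : vec_hom F (v *+ k) = (vec_hom F v ^+ k)%g.
Proof.
by elim: k => [|k IH]; rewrite ?mulr0n ?vec_hom0 // mulrS vec_homD IH expgS.
Qed.

Lemma vec_hom_delta F i : vec_hom F (delta_mx i 0) = F i.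
Proof.
rewrite /vec_hom (eq_bigr (fun j => if j == i then F i else 1)%g) => [|j _].
  rewrite -big_mkcond /= -big_filter.
  have -> : [seq j <- index_enum 'I_n | j == i] = [:: i].
    by rewrite filter_pred1_uniq ?index_enum_uniq ?mem_index_enum.
  by rewrite big_seq1.
rewrite mxE eqxx andbT; case: eqP => [->|_]; last exact: expg0.
by rewrite /= expg_Zp expg1.
Qed.

Lemma vec_expand v : v = \sum_i delta_mx i 0 *+ v i 0%R.
Proof.
apply/colP => i; rewrite summxE (bigD1 i) //= big1 => [|j ji].
  by rewrite addr0 mulmxnE mxE !eqxx natr_Zp.
by rewrite mulmxnE mxE eq_sym (negbTE ji) mul0rn.
Qed.

Definition mx_entries M : {ffun 'I_n * 'I_m -> 'Z_a} := [ffun p => M p.1 p.2].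

Lemma relation_col F M j : relation F (mx_entries M) j = (vec_hom F (col j M) == 1%g).
Proof.
by rewrite /relation /vec_hom; congr (_ == _); apply: eq_bigr => i _;
   rewrite ffunE mxE.
Qed.

Lemma relations_colspan F M : [forall j, relation F (mx_entries M) j] ->
  forall v, v \in colspan M -> vec_hom F v = 1%g.
Proof.
move=> /forallP rel _ /imsetP[v _ ->].
have -> : M *m v = \sum_j col j M *+ v j 0%R.
  apply/colP => i; rewrite mxE summxE; apply: eq_bigr => j _.
  by rewrite mulmxnE mxE -mulr_natr natr_Zp.
rewrite vec_hom_sum big1 // => j _; rewrite vec_homMn.
by have := rel j; rewrite relation_col => /eqP ->; rewrite expg1n.
Qed.

Lemma norm_colspan M v : v \in ('N(colspan M))%g.
Proof.
have sT : colspan M \subset [set: V] by apply/subsetP => w _; rewrite inE.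
have /subsetP := sub_abelian_norm (FinRing.zmod_abelian [set: V]) sT.
by apply; rewrite inE.
Qed.

Definition coset_hom F M : {ffun coset_of (colspan M) -> gT} :=
  [ffun c : coset_of (colspan M) => sgval (vec_hom F (repr c))].

Lemma coset_homE F M v : [forall j, relation F (mx_entries M) j] ->
  coset_hom F M (coset (colspan M) v) = sgval (vec_hom F v).
Proof.
move=> rel; rewrite ffunE; congr sgval.
have /(kercoset_rcoset (norm_colspan _ _) (norm_colspan _ _))[u uM ->] :=
  coset_reprK (coset (colspan M) v).
by rewrite (vec_homD F u v) (relations_colspan rel uM) mul1g.
Qed.

(** The column span is normalized by every vector, so the coset type has no element outside the
    cokernel and the convention of [Sur] on such elements is vacuous. *)
Lemma cokT M (c : coset_of (colspan M)) : c \in cok M.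
Proof.
by have [v vN ->] := cosetP c; apply: mem_quotient; rewrite inE.
Qed.

Lemma vec_hom_onto F : generates F -> forall g, exists v, vec_hom F v = g.
Proof.
move=> /eqP genF g.
have imG : group_set [set vec_hom F v | v in [set: V]].
  apply/group_setP; split; first by apply/imsetP; exists 0; rewrite ?inE ?vec_hom0.
  move=> _ _ /imsetP[u _ ->] /imsetP[v _ ->].
  by apply/imsetP; exists (u + v); rewrite ?inE ?vec_homD.
have : (<<F @: 'I_n>> \subset Group imG)%g.
  rewrite gen_subG; apply/subsetP => _ /imsetP[i _ ->].
  by apply/imsetP; exists (delta_mx i 0); rewrite ?inE ?vec_hom_delta.
rewrite genF => /subsetP/(_ g (in_setT g))/imsetP[v _ ->].
by exists v.
Qed.

(** A homomorphism on the cokernel is determined by the images [F i] of the basis vectors. A family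
    [F] arises in this way if it kills the columns of [M], and surjectivity means that it
    generates. *)
Lemma card_Sur M : #|Sur (cok M) G| =
  #|[set F : {ffun 'I_n -> Gam} | generates F && [forall j, relation F (mx_entries M) j]]|.
Proof.
set good := [set F | _].
have inj : {in good &, injective (fun F => coset_hom F M)}.
  move=> F F'; rewrite !inE => /andP[_ rF] /andP[_ rF'] e.
  apply/ffunP => i; apply: val_inj; rewrite -!(vec_hom_delta _ i).
  by rewrite -[LHS]/(sgval _) -[RHS]/(sgval _) -(coset_homE _ rF) e (coset_homE _ rF').
rewrite -(card_in_imset inj); apply: eq_card => f; rewrite inE.
apply/idP/imsetP => [/and3P[mf /eqP imf _]|[F]]; last first.
  rewrite inE => /andP[gF rF] ->; apply/and3P; split.
  - apply/morphicP => c c' _ _.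
    have [v _ ->] := cosetP c; have [v' _ ->] := cosetP c'.
    rewrite -morphM ?norm_colspan // !coset_homE //.
    by rewrite (vec_homD F v v').
  - apply/eqP/setP => g; apply/imsetP/idP => [[c _ ->]|gG].
      by rewrite ffunE subgP.
    have [v vg] := vec_hom_onto gF (subg G g).
    exists (coset (colspan M) v); first exact: cokT.
    by rewrite coset_homE // vg subgK.
  - by apply/forallP => c; rewrite cokT.
have fG c : f c \in G by rewrite -imf; apply: imset_f; exact: cokT.
pose h v : Gam := subg G (f (coset (colspan M) v)).
have hE v : sgval (h v) = f (coset (colspan M) v) by rewrite subgK.
have hD u v : h (u + v) = (h u * h v)%g.
  apply: val_inj; rewrite -[LHS]/(sgval _) -[RHS]/(sgval _ * sgval _)%g !hE.
  rewrite -[(u + v)%R]/((u : V) * v)%g morphM ?norm_colspan //.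
  by apply: (morphicP mf); exact: cokT.
have h0 : h 0 = 1%g.
  by apply: (mulgI (h 0)); rewrite -hD addr0 mulg1.
have hMn v k : h (v *+ k) = (h v ^+ k)%g.
  by elim: k => [|k IH]; rewrite ?mulr0n ?h0 // mulrS hD IH expgS.
pose F : {ffun 'I_n -> Gam} := [ffun i => h (delta_mx i 0)].
have hF v : h v = vec_hom F v.
  rewrite {1}(vec_expand v) (big_morph h hD h0); apply: eq_bigr => i _.
  by rewrite hMn ffunE.
exists F.
  rewrite inE; apply/andP; split.
    rewrite /generates eqEsubset subsetT /=; apply/subsetP => g _.
    have : sgval g \in G by exact: subgP.
    rewrite -imf => /imsetP[c _]; have [v _ ->] := cosetP c.
    rewrite -hE => /val_inj ->; rewrite hF.
    apply: group_prod => i _; apply: groupX.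
    by apply: mem_gen; apply: imset_f.
  apply/forallP => j; rewrite relation_col -hF; apply/eqP/val_inj.
  rewrite -[LHS]/(sgval _) hE coset_id ?h0.
    (* [f] is only known to be multiplicative; its value at the trivial coset comes from
       [h 0 = 1]. *)
    by rewrite -[X in f X](coset_id (group1 (colspan_group M))) -(hE 0) h0.
  by apply/imsetP; exists (delta_mx j 0); rewrite ?inE // colE.
apply/ffunP => c; rewrite ffunE -hF hE coset_reprK //.
Qed.

End CokernelSurjections.

(** * The law of the matrix *)

(** In a finite ring a non-maximal ideal can be strictly enlarged; the induction is on the number of
    elements outside it, counted through the bijection with [F]. *)
Lemma maximal_ideal_exists (S : comNzRingType) (F : finType) (f : F -> S) (g : S -> F)
    (I : {pred S}) : cancel g f -> cancel f g -> idealr_closed I ->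
  exists2 J : {pred S}, maximal_ideal J & {subset I <= J}.
Proof.
move=> gK fK.
pose size_of (K : {pred S}) := #|[set x | f x \in K]|.
have [k] := ubnP (#|F| - size_of I)%N.
elim: k I => // k IH I; rewrite ltnS => lek idI.
have [max|] := pselect (maximal_ideal I); first by exists I.
move=> nmax.
have [J [idJ IJ nJI]] : exists J : {pred S},
    [/\ idealr_closed J, {subset I <= J} & ~ {subset J <= I}].
  apply: contrapT => nJ; apply: nmax; split => // J idJ IJ.
  by apply: contrapT => nJI; apply: nJ; exists J.
have lt : (size_of I < size_of J)%N.
  apply: proper_card; rewrite properE; apply/andP; split.
    by apply/subsetP => x; rewrite !inE => /IJ.
  apply: contra_notN nJI => /subsetP JI x xJ.
  by have := JI (g x); rewrite !inE gK => /(_ xJ).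
have leF : (size_of J <= #|F|)%N by apply: max_card.
have [|K maxK JK] := IH J _ idJ.
  by apply: leq_trans lek; apply: ltn_sub2l => //; apply: leq_trans leF.
by exists K => // x /IJ/JK.
Qed.

(** * Laws of random variables with finitely many values *)

Section DiscreteLaw.
Variables (R : realType) (d : measure_display) (T : measurableType d).
Variables (P : probability T R) (S : finType) (X : T -> S).
Hypothesis X_discrete : discrete_rv X.
Local Open Scope classical_set_scope.

Definition mass (s : S) : R := fine (P (X @^-1` [set s])).

Lemma mass_ge0 s : 0 <= mass s.
Proof. exact: fine_ge0. Qed.

Lemma mass_EFin s : (mass s)%:E = P (X @^-1` [set s]).
Proof. by rewrite fineK // fin_num_measure //; exact: X_discrete. Qed.

Lemma expectation_mass (f : S -> R) : (forall s, 0 <= f s) ->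
  ('E_P[fun w => f (X w)] = (\sum_s mass s * f s)%:E)%E.
Proof.
move=> f0; rewrite unlock.
have mE (g : S -> R) : measurable_fun [set: T] (fun w => (g (X w))%:E).
  by move=> _ B mB; rewrite classical_sets.setTI; exact: (X_discrete (fun s => B (g s)%:E)).
under eq_integral => w _.
  rewrite (_ : f (X w) = \sum_s f s * (X w == s)%:R); last first.
    rewrite (bigD1 (X w)) //= eqxx mulr1 big1 ?addr0 // => s /negbTE.
    by rewrite eq_sym => ->; rewrite mulr0.
  rewrite -sumEFin; over.
rewrite ge0_integral_sum //; last 2 first.
- by move=> s; apply: (mE (fun x => f s * (x == s)%:R)).
- by move=> s w _; rewrite lee_fin mulr_ge0.
rewrite -sumEFin; apply: eq_bigr => s _.
under eq_integral do rewrite EFinM.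
rewrite ge0_integralZl_EFin //; last exact: (mE (fun x => (x == s)%:R)).
rewrite EFinM mass_EFin muleC; congr (_ * _)%E.
under eq_integral => w _.
  rewrite (_ : (X w == s)%:R = \1_(X @^-1` [set s]) w); first over.
  rewrite indicE; congr (nat_of_bool _)%:R.
  by apply/eqP/idP => [e|/set_mem //]; exact: mem_set.
by rewrite integral_indic ?classical_sets.setIT //; exact: X_discrete.
Qed.

Lemma prob_mass (B : pred S) : P [set w | B (X w)] = (\sum_(s | B s) mass s)%:E.
Proof.
have mB : measurable [set w | B (X w)] by exact: (X_discrete [set s | B s]).
rewrite -expectation_indic //.
rewrite (_ : \1_[set w | B (X w)] = fun w => (B (X w))%:R); last first.
  apply/funext => w; rewrite indicE; congr (nat_of_bool _)%:R.
  by apply/idP/idP => [/set_mem //|Bw]; exact: mem_set.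
rewrite (expectation_mass (f := fun s => (B s)%:R)) //; congr EFin.
by rewrite [RHS]big_mkcond; apply: eq_bigr => s _; case: (B s); rewrite ?mulr1 ?mulr0.
Qed.

Lemma sum_mass : \sum_s mass s = 1.
Proof.
have := prob_mass predT; rewrite (_ : [set w | predT (X w)] = [set: T]).
  by rewrite probability_setT => -[].
by apply/seteqP; split.
Qed.

End DiscreteLaw.

Section StairsLaw.
Variables (R : realType) (d : measure_display) (T : measurableType d).
Variables (P : probability T R) (a n m k : nat) (alpha beta : 'I_k -> nat).
Variables (eps : R) (M : T -> 'M['Z_a]_(n, m)).
Hypothesis a_gt1 : (1 < a)%N.
Hypothesis M_stairs : balanced_stairs P alpha beta eps M.
Local Open Scope classical_set_scope.

Definition entry_mass (p : 'I_n * 'I_m) : 'Z_a -> R :=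
  mass P (fun w => M w p.1 p.2).

Lemma entry_discrete (p : 'I_n * 'I_m) : discrete_rv (fun w => M w p.1 p.2).
Proof.
by case: M_stairs => dM _ _ _ B; exact: (dM [set N | B (N p.1 p.2)]).
Qed.

Lemma entry_mass_stairs p : p \in stairs n m alpha beta ->
  forall x, entry_mass p x = (x == 0)%:R.
Proof.
case: M_stairs => _ M0 _ _; case: p => i j ps x.
rewrite /entry_mass /mass /=; case: eqP => [->|x0].
  rewrite (_ : _ @^-1` _ = [set: T]) ?probability_setT //.
  by apply/seteqP; split => // w _ /=; exact: M0.
rewrite (_ : _ @^-1` _ = classical_sets.set0) ?measure0 //.
by apply/seteqP; split => // w /= e; apply: x0; rewrite -e M0.
Qed.

Lemma matrix_mass (N : 'M['Z_a]_(n, m)) :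
  mass P M N = matrix_law entry_mass (mx_entries N).
Proof.
have [dM M0 _ indM] := M_stairs.
rewrite /matrix_law (bigID (mem (stairs n m alpha beta))) /=.
(* If [N] is nonzero at a forced 0, both sides vanish: the event is empty and one factor of the
   product is 0. *)
have [N0|/existsNP[p Np]] := pselect (forall p, p \in stairs n m alpha beta ->
    N p.1 p.2 = 0); last first.
  have {Np}[ps Np] : p \in stairs n m alpha beta /\ N p.1 p.2 <> 0.
    by split; [apply: contrapT => nps; apply: Np | move=> e; apply: Np].
  rewrite (bigD1 p) //= entry_mass_stairs // ffunE.
  move/eqP/negbTE: (Np) => ->; rewrite !mul0r.
  rewrite /mass (_ : _ @^-1` _ = classical_sets.set0) ?measure0 //.
  apply/seteqP; split => // w /= e; apply: Np; rewrite -e.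
  by apply: M0; rewrite -surjective_pairing.
rewrite big1 ?mul1r => [|p ps]; last first.
  by rewrite entry_mass_stairs // ffunE N0 // eqxx.
(* Independence is applied to all free entries at once; agreeing with [N] there already means being
   equal to [N], since both are 0 on the stairs. *)
have := indM (~: stairs n m alpha beta)%SET (fun p => [set N p.1 p.2]) (subxx _).
rewrite (_ : \bigcap_(i in _) _ = M @^-1` [set N]); last first.
  apply/seteqP; split => w /=.
    move=> e; apply/matrixP => i j.
    have [ij|ij] := boolP ((i, j) \in stairs n m alpha beta).
      by rewrite M0 // -(N0 _ ij).
    by apply: (e (i, j)); rewrite /= inE.
  by move=> <- p _.
rewrite /mass => ->.
rewrite (eq_bigr (fun p => (entry_mass p (N p.1 p.2))%:E)) => [|p _]; last first.
  by rewrite mass_EFin //; exact: entry_discrete.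
rewrite prodEFin /=; apply: eq_big => [p|p _]; first by rewrite inE.
by rewrite ffunE.
Qed.

Lemma entry_mass_ge0 p x : 0 <= entry_mass p x.
Proof. exact: mass_ge0. Qed.

Lemma entry_mass_sum p : \sum_x entry_mass p x = 1.
Proof. exact: sum_mass (entry_discrete p). Qed.

(* The annihilator of y is a proper ideal, hence lies in a maximal one. *)
Lemma entry_mass_balanced p y r : p \notin stairs n m alpha beta -> y != 0 ->
  \sum_(x | (x - r) * y == 0) entry_mass p x <= 1 - eps.
Proof.
case: M_stairs => _ _ bal _; case: p => i j ps y0.
pose I : {pred 'Z_a} := [pred x | x * y == 0].
have idI : idealr_closed I.
  split; rewrite ?inE ?mul0r ?mul1r // => c u v.
  by rewrite !inE mulrDl -mulrA => /eqP -> /eqP ->; rewrite mulr0 addr0.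
have [J maxJ IJ] := maximal_ideal_exists (f := id) (g := id) (frefl _) (frefl _) idI.
have := bal i j ps J maxJ r; rewrite -lee_fin; apply: le_trans.
rewrite -(prob_mass P (@entry_discrete (i, j)) (fun x => (x - r) * y == 0)).
apply: le_measure.
- apply: mem_set; exact: (@entry_discrete (i, j) [set x | (x - r) * y == 0]).
- apply: mem_set; exact: (@entry_discrete (i, j) [set x | x - r \in J]).
by move=> w /= e; apply: IJ.
Qed.

Lemma mx_entries_bij : bijective (@mx_entries a n m).
Proof.
exists (fun f : {ffun 'I_n * 'I_m -> 'Z_a} => \matrix_(i, j) f (i, j)).
  by move=> N; apply/matrixP => i j; rewrite mxE ffunE.
by move=> f; apply/ffunP => -[i j]; rewrite ffunE mxE.
Qed.

Lemma expectation_Sur (gT : finGroupType) (G : {group gT}) :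
  abelian G -> (exponent G %| a)%N ->
  ('E_P[fun w => #|Sur (cok (M w)) G|%:R] =
  (\sum_(F : {ffun 'I_n -> subg_of G} | generates F)
     prob_relations entry_mass F)%:E)%E.
Proof.
move=> abG expG; have [dM _ _ _] := M_stairs.
rewrite (@expectation_mass _ _ _ P _ M dM (fun N => #|Sur (cok N) G|%:R)) //.
congr EFin.
under eq_bigr => N _.
  rewrite matrix_mass (card_Sur a_gt1 abG expG) -sum1_card natr_sum.
  rewrite (eq_bigl (fun F : {ffun 'I_n -> subg_of G} => generates F &&
    [forall j, relation F (mx_entries N) j])); last by move=> F; rewrite inE.
  rewrite big_mkcondr /= mulr_sumr.
  over.
rewrite exchange_big /=; apply: eq_bigr => F _.
rewrite /prob_relations (reindex (@mx_entries a n m)) /=; last first.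
  by apply: onW_bij; exact: mx_entries_bij.
by apply: eq_bigr => N _; case: ifP.
Qed.

End StairsLaw.

(** * The moment *)

Section Moment.
Variables (R : rcfType) (a : nat) (Gam : finGroupType) (I J : finType).
Hypothesis a_gt1 : (1 < a)%N.
Hypothesis Gam_abelian : abelian [set: Gam].
Hypothesis Gam_exp : forall x : Gam, (x ^+ a = 1)%g.
Variable mu : I * J -> 'Z_a -> R.
Variable z : R[i]%C.
Hypothesis z_prim : a.-primitive_root z.
Variables (q : R) (free : I -> J -> bool) (t : nat) (e : R).
Hypothesis q_ge0 : 0 <= q.
Hypothesis mu_ge0 : forall p x, 0 <= mu p x.
Hypothesis mu_sum : forall p, \sum_x mu p x = 1.
Hypothesis char_fun_le : forall i j y, free i j -> y != 0 ->
  `|char_fun mu z (i, j) y| <= q%:C%C.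
Hypothesis card_J : #|J| = (#|I| + t)%N.
Hypothesis avg_weight_le : avg (fun F : {ffun I -> Gam} => (generates F)%:R *
  \prod_j column_weight (@zdual_nz a Gam) q free F j) <= 1 + e.

(** As [#|J| = #|I| + t], summing [#|Gam| ^- #|J|] over the generating families gives [N ^- t * g],
    with [g] their proportion. The sum is within [N ^- t * (1 + e - g)] of this, which is within
    [N ^- t * (1 - g)] of [N ^- t]; the total is at most [e + 2 * (1 - g)]. *)
Lemma sum_prob_relations_dist :
  `|\sum_(F : {ffun I -> Gam} | generates F) prob_relations mu F
    - #|Gam|%:R ^- t| <= e + 2 * ((2 ^ #|Gam|)%:R * 2^-1 ^+ #|I|).
Proof.
set N : R := #|Gam|%:R; set s := \sum_(F : {ffun I -> Gam} | generates F) prob_relations mu F.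
have N_ge1 : 1 <= N.
  by rewrite -[1]/(1%:R) ler_nat; apply/card_gt0P; exists 1%g.
have N_gt0 : 0 < N by apply: lt_le_trans N_ge1.
pose g := avg (fun F : {ffun I -> Gam} => (generates F)%:R) : R.
have NJ (f : {ffun I -> Gam} -> R) :
    \sum_F N ^- #|J| * f F = N ^- t * avg f.
  rewrite -mulr_sumr /avg mulrA -invfM -exprD card_J [(t + _)%N]addnC.
  by [].
have sE : s = \sum_(F : {ffun I -> Gam}) (generates F)%:R * prob_relations mu F.
  rewrite /s big_mkcond; apply: eq_bigr => F _.
  by case: ifP => _; rewrite ?mul1r ?mul0r.
have gE : N ^- t * g = \sum_(F : {ffun I -> Gam}) (generates F)%:R * N ^- #|J|.
  by rewrite -NJ; apply: eq_bigr => F _; rewrite mulrC.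
have d1 : `|s - N ^- t * g| <= N ^- t * (1 + e - g).
  rewrite sE gE -sumrB; apply: le_trans (ler_norm_sum _ _ _) _.
  apply: (@le_trans _ _ (N ^- t * (avg (fun F : {ffun I -> Gam} =>
      (generates F)%:R * \prod_j column_weight (@zdual_nz a Gam) q free F j) - g))).
    rewrite mulrBr gE -NJ -sumrB; apply: ler_sum => F _.
    rewrite -mulrBr normrM ger0_norm // mulrCA -mulrBr ler_wpM2l //.
    exact: (prob_relations_dist a_gt1 Gam_abelian Gam_exp z_prim mu_ge0
              mu_sum char_fun_le).
  by rewrite ler_wpM2l ?lerD2r // invr_ge0 exprn_ge0 // ltW.
have g_le1 : g <= 1.
  rewrite -(@avg_cst R Gam I _ 1); last by apply/card_gt0P; exists 1%g.
  by apply: avg_le => F; case: (generates F).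
have g_ge := avg_generates R Gam I.
rewrite -/g in g_ge.
have Nt : 0 <= N ^- t <= 1.
  rewrite invr_ge0 exprn_ge0 ?(ltW N_gt0) //= invf_le1 ?exprn_gt0 //.
  by rewrite exprn_ege1.
have d2 : `|s - N ^- t| <= N ^- t * (1 + e - g) + N ^- t * (1 - g).
  have -> : s - N ^- t = (s - N ^- t * g) - N ^- t * (1 - g) by ring.
  apply: le_trans (ler_normB _ _) _; rewrite lerD // ger0_norm //.
  by rewrite mulr_ge0 ?subr_ge0 //; case/andP: Nt.
(* Each column weight is at least 1 because of the trivial character, so the mean in [avg_weight_le]
   is at least [g]. *)
have d3 : 0 <= 1 + e - g.
  rewrite subr_ge0; apply: le_trans avg_weight_le; apply: avg_le => F.
  case: (generates F); rewrite ?mul0r // mul1r.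
  apply: (@le_trans _ _ (\prod_(j : J) (1 : R))); first by rewrite big1.
  apply: ler_prod => j _; rewrite ler01 /=.
  rewrite /column_weight (bigD1 (zdual0 a Gam)) //= (_ : #|_| = 0%N) ?expr0.
    by rewrite lerDl; apply: sumr_ge0 => chi _; rewrite exprn_ge0.
  by apply: eq_card0 => i; rewrite !inE /zdual_nz zdual0E eqxx andbF.
apply: (le_trans d2); rewrite -mulrDr.
apply: (@le_trans _ _ (1 + e - g + (1 - g))).
  rewrite ler_piMl ?(andP Nt).2 // addr_ge0 // subr_ge0 //.
by move: g_ge; lra.
Qed.

End Moment.

Lemma char_fun_uniform_bound (R : rcfType) (a : nat) (z : R[i]%C) (eps : R) :
  (1 < a)%N -> a.-primitive_root z -> 0 < eps < 1 ->
  exists2 q : R, 0 < q < 1 &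
  forall (mu : 'Z_a -> R) y, (forall x, 0 <= mu x) -> \sum_x mu x = 1 ->
    (forall r, \sum_(x | (x - r) * y == 0) mu x <= 1 - eps) ->
    `|\sum_x (mu x)%:C%C * ez z (x * y)| <= q%:C%C.
Proof.
move=> a_gt1 z_prim /andP[e0 e1].
have [|eta /andP[eta0 eta1] H] := char_fun_bound a_gt1 z_prim (eps := eps%:C%C).
  by rewrite ltcR lecR e0 ltW.
have /complex_realP[h etaE] : eta \is Num.real by rewrite gtr0_real.
move: eta0 eta1 H; rewrite {}etaE => h0 h1 H.
have {}h0 : 0 < h by rewrite -ltcR.
have {}h1 : h <= 1 by rewrite -lecR.
have he : 0 < h * eps by rewrite mulr_gt0.
have he1 : h * eps < 1.
  by apply: le_lt_trans e1; rewrite ler_piMl // ltW.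
(* The square of this number is at least [1 - h * eps], the bound known for the squared modulus. *)
exists (1 - h * eps / 2); first by apply/andP; split; lra.
move=> mu y mu0 mu1 bal.
rewrite -(@ler_pXn2r _ 2) ?nnegrE //; last first.
  by rewrite ler0c; lra.
apply: le_trans (H (fun x => (mu x)%:C%C) y _ _ _) _.
- by move=> x; rewrite ler0c.
- by rewrite -rmorph_sum mu1 rmorph1.
- move=> r; rewrite -rmorph_sum -(rmorph1 (real_complex R)) -rmorphB /= lecR.
  exact: bal.
rewrite -rmorphXn -rmorphM -(rmorph1 (real_complex R)) -rmorphB /= lecR.
by nra.
Qed.

(** * Square blocks of free entries beside the stairs *)

Section Blocks.
Variables (n t c k : nat) (alpha beta : 'I_k -> nat).
Hypothesis alpha_gt0 : forall l, (0 < alpha l)%N.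
Hypothesis beta_gt0 : forall l, (0 < beta l)%N.
Hypothesis le_cn : (c <= n)%N.
Hypothesis corner : forall l, (alpha l + beta l + c <= n)%N.

Definition block (x : nat) : {set 'I_k} := [set l | (beta l <= x)%N].

Lemma card_ord_lt_block m p (f : nat -> nat) (y : {set 'I_k}) : (p <= m)%N ->
  #|[set i : 'I_m | (i < p)%N && (block (f i) == y)]| =
  (\sum_(i < p | block (f i) == y) 1)%N.
Proof.
move=> pm; rewrite -sum1_card.
rewrite (big_ord_widen_cond _ (fun i => block (f i) == y) (fun=> 1%N) pm).
by apply: eq_bigl => i; rewrite inE andbC.
Qed.

Lemma card_last_ord m p : (p <= m)%N -> #|[set i : 'I_m | (p <= i)%N]| = (m - p)%N.
Proof.
move=> pm; have := cardsC [set i : 'I_m | (p <= i)%N]; rewrite card_ord.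
have -> : #|~: [set i : 'I_m | (p <= i)%N]| = p.
  rewrite -[RHS]card_ord -[RHS]sum1_card (big_ord_widen _ (fun=> 1%N) pm).
  by rewrite -sum1_card; apply: eq_bigl => i; rewrite !inE -ltnNge.
by lia.
Qed.

(** Row [i < p] gets the label of column [p - i.+1], where [p = n - c]. If [(i, j)] were in step
    [l], then [j < beta l], so with equal labels [p - i.+1 < beta l]; together with [i < alpha l]
    this contradicts [alpha l + beta l <= p]. *)
Lemma stairs_blocks :
  exists (R0 : {set 'I_n}) (S : {set 'I_(n + t)}) (lam : 'I_n -> {set 'I_k})
    (mu : 'I_(n + t) -> {set 'I_k}),
  [/\ #|R0| = c /\ #|S| = (c + t)%N,
   forall y, #|[set i | (i \notin R0) && (lam i == y)]| =
             #|[set j | (j \notin S) && (mu j == y)]|,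
   forall i j, j \in S -> (i, j) \notin stairs n (n + t) alpha beta,
   forall i j, i \in R0 -> (i, j) \notin stairs n (n + t) alpha beta
 & forall i j, j \notin S -> lam i = mu j ->
     (i, j) \notin stairs n (n + t) alpha beta].
Proof.
pose p := (n - c)%N.
exists [set i : 'I_n | (p <= i)%N], [set j : 'I_(n + t) | (p <= j)%N].
exists (fun i => block (p - i.+1)), (fun j => block j).
have free_R0 (i : 'I_n) (j : 'I_(n + t)) : (p <= i)%N ->
    (i, j) \notin stairs n (n + t) alpha beta.
  move=> pi; rewrite inE negb_exists; apply/forallP => l /=.
  by have := alpha_gt0 l; have := beta_gt0 l; have := corner l; rewrite /p in pi; lia.
split.
- by rewrite !card_last_ord /p; lia.
- move=> y.
  have -> : [set i : 'I_n | (i \notin [set i : 'I_n | (p <= i)%N]) &&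
      (block (p - i.+1) == y)] =
      [set i : 'I_n | (i < p)%N && (block (p - i.+1) == y)].
    by apply/setP => i; rewrite !inE -ltnNge.
  have -> : [set j : 'I_(n + t) | (j \notin [set j : 'I_(n + t) | (p <= j)%N]) &&
      (block j == y)] = [set j : 'I_(n + t) | (j < p)%N && (block j == y)].
    by apply/setP => j; rewrite !inE -ltnNge.
  rewrite (card_ord_lt_block (fun i => p - i.+1)%N) ?leq_subr //.
  rewrite (card_ord_lt_block id); last by rewrite /p; lia.
  (* Reversing the order of the first [p] indices matches rows with columns of the same label, so
     the blocks are square. *)
  rewrite (reindex_inj rev_ord_inj) /=; apply: eq_bigl => i /=.
  by congr (block _ == _); have := ltn_ord i; lia.
- move=> i j; rewrite inE => pj; rewrite inE negb_exists; apply/forallP => l /=.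
  by have := alpha_gt0 l; have := beta_gt0 l; have := corner l; rewrite /p in pj; lia.
- by move=> i j; rewrite inE; exact: free_R0.
move=> i j; rewrite inE -ltnNge => jp eb.
have [pi|ip] := leqP p i; first exact: free_R0.
rewrite inE negb_exists; apply/forallP => l /=.
have /setP/(_ l) := eb; rewrite !inE.
have := alpha_gt0 l; have := beta_gt0 l; have := corner l.
by rewrite /p in ip *; lia.
Qed.

End Blocks.

(** * The limit of the moments *)

Local Open Scope classical_set_scope.

Theorem theorem10p1 (R : realType) (a : nat) (ha : (2 <= a)%N)
  (eps : R) (heps : 0 < eps < 1) (t k : nat) (hk : (0 < k)%N)
  (n0 : nat) (alpha beta : nat -> 'I_k -> nat)
  (hshape : forall n, (n0 <= n)%N ->
     stair_shape n (n + t) (alpha n) (beta n))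
  (d : nat -> measure_display) (T : forall n, measurableType (d n))
  (P : forall n, probability (T n) R)
  (M : forall n, T n -> 'M['Z_a]_(n, n + t))
  (hM : forall n, (n0 <= n)%N ->
     balanced_stairs (P n) (alpha n) (beta n) eps (M n))
  (hlim : forall l : 'I_k,
     (n%:R - (alpha n l)%:R - (beta n l)%:R : R) @[n --> \oo] --> +oo)
  (gT : finGroupType) (G : {group gT}) (hG : abelian G)
  (hexp : (exponent G %| a)%N) :
  'E_(P n)[fun w => #|Sur (cok (M n w)) G|%:R]%E @[n --> \oo]
    --> ((#|G|%:R ^+ t)^-1 : R)%:E.
Proof.
have Gam_ab := subg_abelian hG; have Gam_exp := subg_expg hexp.
have a_neq0 : a%:R != 0 :> R[i]%C by rewrite pnatr_eq0; lia.
have [z z_prim] := prim_root_exists a_neq0.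
have [q q01 charq] := char_fun_uniform_bound ha z_prim heps.
(* The expectation must be eventually finite, which holds as it is a finite sum of reals; then its
   real value must converge. *)
apply/fine_cvgP; split.
  near=> n; rewrite (@expectation_Sur _ _ _ (P n) _ _ _ _ _ _ _ _ ha (hM n _)) //.
  by near: n; exact: nbhs_infty_ge.
apply/cvgrPdist_le => e e0.
have e2 : 0 < e / 2 by rewrite divr_gt0.
have Gam0 : (0 < #|{: subg_of G}|)%N by apply/card_gt0P; exists 1%g.
have nz0 (g : subg_of G) : zdual_nz (zdual0 a _) g = false.
  by rewrite /zdual_nz zdual0E eqxx.
(* This [c] depends on [e] but not on [n]; the labels are subsets of ['I_k], so the number of blocks
   is bounded independently of [n]. *)
have [c Hc] := avg_staircase_cvg {set 'I_k} t Gam0 nz0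
  (card_zdual_annihilator ha z_prim) q01 e2.
have small : \forall n \near \oo,
    2 * ((2 ^ #|{: subg_of G}|)%:R * 2^-1 ^+ n) <= e / 2 :> R.
  have h : (2 * ((2 ^ #|{: subg_of G}|)%:R * 2^-1 ^+ n) : R) @[n --> \oo] --> (0 : R).
    rewrite [X in _ --> X](_ : (0 : R) = 2 * ((2 ^ #|{: subg_of G}|)%:R * 0));
      last by rewrite !mulr0.
    apply: cvgM; first exact: cvg_cst.
    apply: cvgM; first exact: cvg_cst.
    by apply: cvg_expr; rewrite ger0_norm ?invr_ge0 // invf_lt1 // ltr1n.
  have : \forall n \near \oo, 2 * ((2 ^ #|{: subg_of G}|)%:R * 2^-1 ^+ n) < e / 2 :> R.
    by exact: cvgr_lt h _ e2.
  by apply: filterS => n /ltW.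
(* Only here does the divergence hypothesis enter: every corner of the stairs eventually stays at
   distance at least the fixed [c] from the antidiagonal. *)
have corner : \forall n \near \oo, forall l, (alpha n l + beta n l + c <= n)%N.
  apply: filter_forall => l.
  have /cvgryPge/(_ c%:R) := hlim l.
  apply: filterS => n.
  by rewrite lerBrDr lerBrDr -!natrD ler_nat; lia.
near=> n.
have n0n : (n0 <= n)%N by near: n; exact: nbhs_infty_ge.
have cn : (c <= n)%N by near: n; exact: nbhs_infty_ge.
have cornern : forall l, (alpha n l + beta n l + c <= n)%N by near: n.
have smalln : 2 * ((2 ^ #|{: subg_of G}|)%:R * 2^-1 ^+ n) <= e / 2 :> R by near: n.
have hMn := hM n n0n.
have [alphaP _ betaP _] := hshape n n0n.
have [R0 [S [lam [mu [[cR0 cS] cb fS fR fb]]]]] :=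
  stairs_blocks t (fun l => proj1 (andP (alphaP l))) (fun l => proj1 (andP (betaP l)))
    cn cornern.
have genP (F : {ffun 'I_n -> subg_of G}) : generates F ->
    forall chi, chi != zdual0 a _ -> exists i, zdual_nz chi (F i).
  by move=> /eqP gF; exact: zdual_generated.
have avgle := Hc c (leqnn c) _ _
  (fun i j => (i, j) \notin stairs n (n + t) (alpha n) (beta n))
  R0 S lam mu cR0 cS cb fS fR fb (@generates _ _) genP.
have cf i j y : (i, j) \notin stairs n (n + t) (alpha n) (beta n) -> y != 0 ->
    `|char_fun (entry_mass (P n) (M n)) z (i, j) y| <= q%:C%C.
  move=> ij y0; apply: charq => [x||r].
  - exact: entry_mass_ge0.
  - exact: (entry_mass_sum hMn (i, j)).
  - exact: (entry_mass_balanced hMn r ij y0).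
rewrite distrC /= (expectation_Sur ha hMn hG hexp) /=.
have cardJ : #|'I_(n + t)| = (#|'I_n| + t)%N by rewrite !card_ord.
have q0 : 0 <= q by case/andP: q01 => /ltW.
have := sum_prob_relations_dist ha Gam_ab Gam_exp z_prim q0
  (entry_mass_ge0 (P n) (M n)) (entry_mass_sum hMn) cf cardJ avgle.
have cG : #|{: subg_of G}| = #|G| by rewrite card_sub; exact: eq_card.
rewrite -cG card_ord => /le_trans; apply.
by rewrite [X in _ <= X](splitr e) lerD2l.
Unshelve. all: by end_near.
Qed.
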